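(* Let $X$ be a normed space over $\mathbb{R}$ with $\dim X\ge 2$. Let $n,k$ be integers with $1\le k\le n-1$ and suppose that $r\colon X(n)\to X(k)$ is a Lipschitz retraction. Then $$\operatorname{Lip}(r)\ge \frac{kn}{2\pi(n-1)}-\frac12 .$$ Moreover, if $X$ is a Hilbert space, then $$\operatorname{Lip}(r)\ge \frac{kn}{\pi(n-1)}-1 .$$
   Context: For a metric space $(X,d)$ and a positive integer $n$, $X(n)$ denotes the $n$th finite subset space of $X$: the set of all nonempty subsets of $X$ of cardinality at most $n$, with the Hausdorff distance $d_H(A,B)=\max\{\max_{a\in A}\min_{b\in B}d(a,b),\ \max_{b\in B}\min_{a\in A}d(a,b)\}$. For $k\le n$ we regard $X(k)\subset X(n)$. A normed space carries the metric induced by its norm. A map $f\colon M\to N$ between metric spaces is Lipschitz if there is $L\ge 0$ with $d(f(x),f(x'))\le L\,d(x,x')$ for all $x,x'\in M$; the least such $L$ is denoted $\operatorname{Lip}(f)$. If $N\subset M$, a Lipschitz retraction $r\colon M\to N$ is a Lipschitz map whose restriction to $N$ is the identity. *)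

(* Defs.v *)
From HB Require Import structures.
From mathcomp Require Import all_boot all_order all_algebra finmap sesquilinear.
From mathcomp Require Import all_classical all_reals all_analysis.

Set Implicit Arguments.
Unset Strict Implicit.
Unset Printing Implicit Defensive.

Import Order.TTheory GRing.Theory Num.Theory.
Import numFieldNormedType.Exports.

Local Open Scope classical_set_scope.
Local Open Scope ring_scope.

(* The library does not declare a normed space to be a [metricType]; the alias
   [normed_metric X] carries that structure. *)
Definition normed_metric (R : realType) (X : normedModType R) : Type := X.

Section NormedMetric.
Context {R : realType} (X : normedModType R).

HB.instance Definition _ := NormedModule.on (normed_metric X).

Let dist (x y : normed_metric X) : R := `|x - y|.

Let dist_ge0 x y : 0 <= dist x y. Proof. exact: normr_ge0. Qed.

Let dist_positivity x y : dist x y = 0 -> x = y.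
Proof. by move/normr0_eq0/eqP; rewrite subr_eq0 => /eqP. Qed.

Let ballEdist (x : normed_metric X) (e : R) : ball x e = [set y | dist x y < e].
Proof. by rewrite -ball_normE. Qed.

HB.instance Definition _ := @PseudoMetric_isMetric.Build R (normed_metric X)
  dist dist_ge0 dist_positivity ballEdist.

End NormedMetric.

Section HausdorffDistance.
Context {R : realType} {M : metricType R}.
Implicit Types (a b x : M) (A B C : {fset M}).

(* For finite nonempty sets the infima and suprema below are minima and maxima,
   see [dist_to_min] and [excess_max]. *)
Definition dist_to a B : R := inf [set mdist a b | b in [set` B]].

Definition excess A B : R := sup [set dist_to a B | a in [set` A]].

Definition hausdorff_dist A B : R := Num.max (excess A B) (excess B A).

Lemma dist_to_le a b B : b \in B -> dist_to a B <= mdist a b.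
Proof.
move=> bB; apply: ge_inf; last by exists b.
by exists 0 => _ [c _ <-]; exact: mdist_ge0.
Qed.

Lemma fset_min (f : M -> R) A : A != fset0 ->
  exists2 a, a \in A & forall b, b \in A -> f a <= f b.
Proof.
move=> /fset0Pn[a aA].
have [i _ im] := @arg_minP _ _ _ [` aA]%fset xpredT (f \o val) isT.
by exists (val i); [exact: valP | move=> b bA; exact: (im [` bA]%fset)].
Qed.

Lemma dist_to_min a B : B != fset0 ->
  exists2 b, b \in B & dist_to a B = mdist a b.
Proof.
move=> /(fset_min (mdist a))[b bB bm]; exists b => //.
apply/eqP; rewrite eq_le dist_to_le//=; apply: lb_le_inf.
  by exists (mdist a b), b.
by move=> _ [c cB <-]; exact: bm.
Qed.

Lemma excess_has_max A B : A != fset0 ->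
  exists2 a, a \in A & forall b, b \in A -> dist_to b B <= dist_to a B.
Proof.
move=> /(fset_min (fun a => - dist_to a B))[a aA am]; exists a => // b bA.
by rewrite -lerN2 am.
Qed.

Lemma excess_ge a A B : a \in A -> dist_to a B <= excess A B.
Proof.
move=> aA; have A0 : A != fset0 by apply/fset0Pn; exists a.
have [c cA cm] := excess_has_max B A0.
apply: ub_le_sup; last by exists a.
by exists (dist_to c B) => _ [b bA <-]; exact: cm.
Qed.

Lemma excess_max A B : A != fset0 ->
  exists2 a, a \in A & excess A B = dist_to a B.
Proof.
move=> A0; have [a aA am] := excess_has_max B A0; exists a => //.
apply/eqP; rewrite eq_le excess_ge// andbT; apply: ge_sup.
  by exists (dist_to a B), a.
by move=> _ [b bA <-]; exact: am.
Qed.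

Lemma dist_to_self a A : a \in A -> dist_to a A = 0.
Proof.
move=> aA; apply/eqP; rewrite eq_le -{1}(mdistxx a) dist_to_le//=.
have A0 : A != fset0 by apply/fset0Pn; exists a.
by have [b _ ->] := dist_to_min a A0; exact: mdist_ge0.
Qed.

Lemma excess_self A : A != fset0 -> excess A A = 0.
Proof. by move=> A0; have [a /dist_to_self <-] := excess_max A A0. Qed.

Lemma excess_sub A B : B != fset0 -> excess A B <= 0 ->
  {subset A <= B}.
Proof.
move=> B0 AB a aA; have [b bB e] := dist_to_min a B0.
suff /mdist_positivity -> : mdist a b = 0 by [].
by apply/eqP; rewrite eq_le mdist_ge0 andbT -e (le_trans _ AB) ?excess_ge.
Qed.

Lemma excess_triangle A B C : A != fset0 -> B != fset0 -> C != fset0 ->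
  excess A C <= excess A B + excess B C.
Proof.
move=> A0 B0 C0; have [a aA ->] := excess_max C A0.
have [b bB e] := dist_to_min a B0; have [c cC e'] := dist_to_min b C0.
apply: (le_trans (dist_to_le a cC)).
apply: (le_trans (metric_triangle a b c)).
by rewrite -e -e' lerD ?excess_ge.
Qed.

End HausdorffDistance.

Record finite_subset (R : realType) (M : metricType R) (n : nat) := FiniteSubset {
  fset_of :> {fset M};
  _ : (fset_of != fset0) && (#|` fset_of| <= n)%N }.

Section FiniteSubsetSpace.
Context {R : realType} (M : metricType R) (n : nat).
Local Notation Mn := (finite_subset M n).

HB.instance Definition _ := [isSub of Mn for @fset_of R M n].
HB.instance Definition _ := [Choice of Mn by <:].

Let dist (A B : Mn) : R := hausdorff_dist A B.

Let neq0 (A : Mn) : A != fset0 :> {fset M}.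
Proof. by case: A => A /= /andP[]. Qed.

Let distxx A : dist A A = 0.
Proof. by rewrite /dist /hausdorff_dist excess_self// maxxx. Qed.

Let dist_positivity A B : dist A B = 0 -> A = B.
Proof.
move=> AB; apply/val_inj/fsetP => x.
have [h1 h2] : excess A B <= 0 /\ excess B A <= 0.
  by rewrite -AB; split; rewrite le_max lexx ?orbT.
by apply/idP/idP; apply: excess_sub; rewrite ?neq0.
Qed.

Let dist_sym A B : dist A B = dist B A.
Proof. exact: maxC. Qed.

Let dist_triangle B A C : dist A C <= dist A B + dist B C.
Proof.
rewrite ge_max; apply/andP; split.
  by apply: (le_trans (excess_triangle (neq0 A) (neq0 B) (neq0 C)));
    rewrite lerD// le_max lexx.
apply: (le_trans (excess_triangle (neq0 C) (neq0 B) (neq0 A))).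
by rewrite addrC lerD// le_max lexx orbT.
Qed.

HB.instance Definition _ :=
  isMetric.Build R Mn distxx dist_positivity dist_sym dist_triangle.

End FiniteSubsetSpace.

Section Lipschitz.
Context {R : realType} {M N : metricType R}.
Implicit Type f : M -> N.

Definition lipschitz_constants f : set R :=
  [set L | 0 <= L /\ forall x y, mdist (f x) (f y) <= L * mdist x y].

Definition is_lipschitz f : Prop := lipschitz_constants f !=set0.

Definition Lip f : R := inf (lipschitz_constants f).

Lemma Lip_least f : is_lipschitz f ->
  lipschitz_constants f (Lip f) /\ lbound (lipschitz_constants f) (Lip f).
Proof.
move=> f0; have lb0 : lbound (lipschitz_constants f) 0 by move=> L [].
split; last by move=> L fL; apply: ge_inf => //; exists 0.
split; first exact: lb_le_inf.
move=> x y; have [->|xy] := eqVneq x y; first by rewrite !mdistxx mulr0.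
rewrite -ler_pdivrMr ?mdist_gt0//; apply: lb_le_inf => // L [_ fL].
by rewrite ler_pdivrMr ?mdist_gt0.
Qed.

End Lipschitz.

(* [X(k)] is included in [X(n)] as the set of those [A] in [X(n)] that have at
   most [k] elements. *)
Definition lipschitz_retraction (R : realType) (M : metricType R) (n k : nat)
    (r : finite_subset M n -> finite_subset M k) : Prop :=
  is_lipschitz r /\
  forall A : finite_subset M n, (#|` A| <= k)%N -> r A = A :> {fset M}.

Definition dim_ge (R : realType) (X : lmodType R) (m : nat) : Prop :=
  exists e : 'I_m -> X, forall c : 'I_m -> R,
    \sum_(i < m) c i *: e i = 0 -> forall i, c i = 0.

Definition is_hilbert (R : realType) (X : normedModType R) : Prop :=
  (exists ip : {dot X for idfun}, forall x : X, ip x x = `|x| ^+ 2) /\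
  (forall F : set_system X, ProperFilter F -> cauchy F -> cvg F).

(* Main.v *)
(** A plane in [X], with a Lipschitz projection onto it, turns
    [r] into a map [rho] on the finite subsets of the Euclidean plane with at
    most [k + 1] points, with values of at most [k] points, which fixes the sets
    with at most [k] points and is [L]-Lipschitz, where [L] is [Lip r] for a
    Hilbert space (orthogonal projection) and is arbitrarily close to
    [2 * Lip r] for a normed space (almost Auerbach basis of the plane and
    McShane extension of the coordinates).

    Suppose that [(L + 1) * pi / (k + 1) < 1].  Merging the two closest of [k + 1]
    points of the unit circle moves them by at most [pi / (k + 1)], hence for [A]
    on the circle [rho A] avoids a neighbourhood of [0], and it has a point in the
    left half plane if [A] contains [(-1, 0)].  For [k] odd, let [y] run over the
    simplex [-pi <= y_1 <= ... <= y_(k+1) <= pi] and [A] be the set of the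
    [exp (i y_j)]; on the [k] faces [y_j = y_(j+1)] the set [rho A = A] sweeps out
    the [k]-point subsets near [(1, 0)] once, while on the other two faces it has a
    point in the left half plane and contributes nothing.  For [k] even, take [k]
    variables and add the point [(-1, 0)]: now [rho A = A] on all [k + 1] faces, and
    the [k - 1] points in the right half plane are counted.  In both cases the
    number of faces which count is odd, but the boundary of a simplex has even
    degree.  The degree is computed combinatorially, as the parity of the number
    of completely labelled simplices of an iterated barycentric subdivision. *)
Require Import Defs.
From mathcomp Require Import all_boot all_order all_algebra finmap sesquilinear.
From mathcomp Require Import all_classical all_reals all_analysis.
From mathcomp Require Import lra ring zify.
Set Implicit Arguments.
Unset Strict Implicit.
Unset Printing Implicit Defensive.
Import Order.TTheory GRing.Theory Num.Theory.
Import numFieldNormedType.Exports.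
Local Open Scope classical_set_scope.
Local Open Scope ring_scope.

(** * Cochains mod 2 and their coboundary *)

Section Cochains.
Context {T : Type}.
Implicit Types (c : seq T -> bool) (s : seq T).

(* A simplex is the sequence of its vertices, a cochain mod 2 is a boolean function
   of simplices; degenerate simplices are not excluded. *)
Fixpoint faces (s : seq T) : seq (seq T) :=
  if s is x :: s' then s' :: map (cons x) (faces s') else [::].

Definition cobd c s : bool := \big[addb/false]_(t <- faces s) c t.

Lemma cobd_cons c x s :
  cobd c (x :: s) = c s (+) cobd (fun t => c (x :: t)) s.
Proof. by rewrite /cobd /= big_cons big_map. Qed.

Lemma cobd_split c c' s :
  cobd (fun t => c t (+) c' t) s = cobd c s (+) cobd c' s.
Proof. exact: big_split. Qed.

Lemma cobd_cobd c s : cobd (cobd c) s = false.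
Proof.
elim: s c => [|x s IHs] c; first by rewrite /cobd big_nil.
rewrite cobd_cons (_ : (fun t => cobd c (x :: t)) =
  fun t => c t (+) cobd (fun u => c (x :: u)) t).
  by rewrite cobd_split IHs addbF addbb.
by apply/funext => t; rewrite cobd_cons.
Qed.

Lemma size_faces s : size (faces s) = size s.
Proof. by elim: s => //= x s <-; rewrite size_map. Qed.

Lemma nth_faces s i : (i < size s)%N ->
  nth [::] (faces s) i = take i s ++ drop i.+1 s.
Proof.
elim: s i => [|x s IHs] [|i] //= ilt; first by rewrite drop0.
by rewrite (nth_map [::]) ?size_faces// IHs.
Qed.

End Cochains.

(** * Faces with prescribed labels *)

Section FacesEq.
Context {T : eqType}.
Implicit Types (c : seq T -> bool) (s t : seq T).

Lemma mem_faces s t : t \in faces s ->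
  size s = (size t).+1 /\ {subset t <= s}.
Proof.
elim: s t => [|x s IHs] t //=; rewrite inE => /orP[/eqP->|].
  by split=> // y ys; rewrite inE ys orbT.
move=> /mapP[u /IHs[-> us] ->]; split=> // y.
by rewrite !inE => /orP[->//|/us ->]; rewrite orbT.
Qed.

Lemma eq_cobd c c' s :
  (forall t, size s = (size t).+1 -> {subset t <= s} -> c t = c' t) ->
  cobd c s = cobd c' s.
Proof. by move=> cc'; apply: eq_big_seq => t /mem_faces[]; exact: cc'. Qed.

Lemma big_addb (a : pred T) s :
  \big[addb/false]_(x <- s) a x = odd (count a s).
Proof.
by elim: s => [|x s IHs]; rewrite ?big_nil// big_cons IHs /= oddD oddb.
Qed.

Lemma perm_eq_consr (x z : T) s : perm_eq (x :: s) (z :: s) = (x == z).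
Proof.
apply/idP/eqP => [/permP/(_ (pred1 x))|->//] /=.
by rewrite eqxx => /addIn; case: eqP.
Qed.

Lemma faces_perm_sum s t : \big[addb/false]_(u <- faces s) perm_eq u t =
  \big[addb/false]_(x <- s) perm_eq s (x :: t).
Proof.
suff H p : \big[addb/false]_(u <- faces s) perm_eq (p ++ u) t =
  \big[addb/false]_(x <- s) perm_eq (p ++ s) (x :: t) by exact: (H [::]).
elim: s p => [|y s IHs] p /=; first by rewrite !big_nil.
rewrite !big_cons big_map; congr addb.
  have /permPl -> : perm_eq (p ++ y :: s) (y :: p ++ s).
    by rewrite (perm_catCA p [:: y] s).
  by rewrite perm_cons.
under eq_bigr do rewrite -cat_rcons.
by rewrite IHs cat_rcons.
Qed.

(** At most one value [x] makes [s] a permutation of [x :: t]. It occurs once in [s] if it is not in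
    [t] and twice otherwise, so only the first case is odd. *)
Lemma faces_perm_parity s t : uniq t ->
  \big[addb/false]_(u <- faces s) perm_eq u t =
  has (fun x => (x \notin t) && perm_eq s (x :: t)) s.
Proof.
move=> ut; rewrite faces_perm_sum.
have [/hasP[x xs sxt]|/hasPn no] := boolP (has (fun x => perm_eq s (x :: t)) s).
  under eq_bigr do rewrite (permPl sxt) perm_eq_consr.
  under eq_bigr do rewrite eq_sym.
  rewrite (big_addb (pred1 x)) (permP sxt) /= eqxx count_uniq_mem// add1n /= oddb.
  apply/idP/hasP => [xt|[z zs /andP[zt szt]]]; first by exists x; rewrite ?xt.
  by move: szt; rewrite (permPl sxt) perm_eq_consr => /eqP->.
rewrite big_seq big1 => [|x /no/negbTE//].
by apply/esym/negbTE/hasPn => x /no/negbTE->; rewrite andbF.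
Qed.

End FacesEq.

(** * Barycentric subdivision *)

Section Subdivision.
Context {R : realType}.
Notation point := (nat -> R).
Implicit Types (c : seq point -> bool) (s t : seq point) (C : point -> Prop).

Definition bary s : point := fun l => (size s)%:R^-1 * \sum_(v <- s) v l.

(* The sum mod 2 of [c] over the barycentric subdivision of the simplex [s] with
   [n] vertices: the cone with apex [bary s] over the subdivided boundary. *)
Fixpoint sdn n c s : bool :=
  if n is n'.+1 then cobd (sdn n' (fun t => c (bary s :: t))) s else c [::].

Definition sd c s : bool := sdn (size s) c s.

Lemma sdn_split n c c' s :
  sdn n (fun t => c t (+) c' t) s = sdn n c s (+) sdn n c' s.
Proof.
elim: n c c' s => //= n IHn c c' s; rewrite -cobd_split.
by apply: eq_bigr => t _; rewrite IHn.
Qed.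

(** The boundary of a cone is its base plus the cone over the boundary of the base. The latter cones
    cancel by [cobd_cobd], and the bases form the subdivided boundary. *)
Lemma sdn_cobd n c s : size s = n -> sdn n (cobd c) s = cobd (sdn n.-1 c) s.
Proof.
elim: n c s => [|n IHn] c s; first by move/size0nil->; rewrite /= /cobd /= !big_nil.
move=> ss /=.
have -> : (fun t => cobd c (bary s :: t)) =
    (fun t => c t (+) cobd (fun u => c (bary s :: u)) t).
  by apply/funext => t; rewrite cobd_cons.
rewrite (_ : sdn n _ = fun t =>
  sdn n c t (+) sdn n (cobd (fun u => c (bary s :: u))) t); last first.
  by apply/funext => t; rewrite sdn_split.
rewrite cobd_split.
rewrite -[RHS]addbF; congr addb.
rewrite -[RHS](cobd_cobd (sdn n.-1 (fun u => c (bary s :: u))) s).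
by apply: eq_cobd => t; rewrite ss => -[tn] _; rewrite IHn.
Qed.

Lemma sd_cobd c : sd (cobd c) = cobd (sd c).
Proof.
apply/funext => s; rewrite /sd sdn_cobd//.
by apply: eq_cobd => t -> _.
Qed.

Lemma iter_sd_cobd r c : iter r sd (cobd c) = cobd (iter r sd c).
Proof. by elim: r => //= r ->; rewrite sd_cobd. Qed.

Lemma iter_sd0 r : iter r sd (fun=> false) = fun=> false.
Proof.
elim: r => //= r ->; apply/funext => s; rewrite /sd.
by elim: (size s) {2}s => //= n IHn {}s; rewrite /cobd big1.
Qed.

Lemma iter_sd_point r c (x : point) : iter r sd c [:: x] = c [:: x].
Proof.
elim: r => //= r <-; rewrite /sd /= /cobd /= big_seq1 /=; congr (iter _ _ _ [:: _]).
by apply/funext => l; rewrite /bary big_seq1 invr1 mul1r.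
Qed.

Lemma faces_map (T U : Type) (h : T -> U) (s : seq T) :
  faces (map h s) = map (map h) (faces s).
Proof.
by elim: s => //= x s ->; congr cons; rewrite -!map_comp.
Qed.

(** Precomposition with [h] is linear on points, so it commutes with barycentres. With a degeneracy
    for [h] it carries the subdivision of a simplex to that of a face. *)
Lemma iter_sd_reindex r c (h : nat -> nat) s :
  iter r sd c (map (fun y => y \o h) s) =
  iter r sd (fun t => c (map (fun y => y \o h) t)) s.
Proof.
elim: r s => //= r IHr s.
rewrite [in RHS](_ : iter r sd _ =
  (fun t => iter r sd c (map (fun y => y \o h) t))); last exact/funext.
rewrite /sd size_map; elim: (size s) (iter r sd c) {2 4}s => //= n IHn c' s'.
rewrite /cobd faces_map big_map; apply: eq_bigr => t _; rewrite IHn.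
congr (sdn n _ t); apply/funext => u /=; congr (c' (_ :: _)).
by apply/funext => l; rewrite /bary size_map big_map.
Qed.

Definition barycentric C := forall s, s != [::] ->
  (forall v, v \in s -> C v) -> C (bary s).

Definition mesh_le (w : R) s := forall u v, u \in s -> v \in s ->
  forall l, `|u l - v l| <= w.

(** In the average of the differences [v l - u l] the term of [v] itself is zero, whence a factor
    below 1. *)
Lemma bary_dist (s : seq point) (v : point) l (w : R) : v \in s -> mesh_le w s ->
  `|v l - bary s l| <= (size s).-1%:R / (size s)%:R * w.
Proof.
move=> vs sw; have s0 : (size s)%:R != 0 :> R by case: s vs {sw} => // *; rewrite pnatr_eq0.
have -> : v l - bary s l = (size s)%:R^-1 * \sum_(u <- s) (v l - u l).
  rewrite sumrB big_const_seq count_predT iter_addr_0 mulrBr.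
  by rewrite -[v l *+ _]mulr_natl mulKf.
rewrite normrM ger0_norm ?invr_ge0// mulrAC [_ * w * _]mulrC ler_wpM2l ?invr_ge0//.
apply: (le_trans (ler_norm_sum _ _ _)).
rewrite (big_rem v vs) /= subrr normr0 add0r -(size_rem vs).
rewrite mulr_natl.
have -> : w *+ size (rem v s) = \sum_(u <- rem v s) w.
  by rewrite big_const_seq count_predT iter_addr_0.
by rewrite !big_seq ler_sum// => u /mem_rem us; exact: sw.
Qed.

Lemma barycentric_ball (b : point) (w : R) :
  barycentric (fun v => forall l, `|v l - b l| <= w).
Proof.
move=> s s0 sw l.
have s0' : (size s)%:R != 0 :> R by case: s s0 {sw} => // *; rewrite pnatr_eq0.
have -> : bary s l - b l = (size s)%:R^-1 * \sum_(u <- s) (u l - b l).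
  rewrite sumrB big_const_seq count_predT iter_addr_0 mulrBr.
  by rewrite -[b l *+ _]mulr_natl mulKf.
rewrite normrM ger0_norm ?invr_ge0// mulrC ler_pdivrMr ?lt0r ?s0'//=.
apply: (le_trans (ler_norm_sum _ _ _)).
have -> : w * (size s)%:R = \sum_(u <- s) w.
  by rewrite big_const_seq count_predT iter_addr_0 mulr_natr.
by rewrite !big_seq ler_sum// => u us; exact: sw.
Qed.

(** Only simplices of the subdivision enter the sum; their vertices lie in [C] and their mesh has
    shrunk. *)
Lemma sdn_local n c c' s C (w : R) : barycentric C -> size s = n ->
  (forall v, v \in s -> C v) -> mesh_le w s ->
  (forall t, size t = n -> (forall v, v \in t -> C v) ->
    mesh_le (n.-1%:R / n%:R * w) t -> c t = c' t) ->
  sdn n c s = sdn n c' s.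
Proof.
elim: n c c' s C w => [|n IHn] c c' s C w conv.
  by move/size0nil-> => _ _ cc' /=; apply: cc'.
move=> ss sC sw cc' /=.
have s0 : s != [::] by case: s ss {sC sw}.
have w0 : 0 <= w.
  case: s s0 sw {ss sC} => // v s _ /(_ v v); rewrite mem_head => /(_ isT isT 0%N).
  by rewrite subrr normr0.
apply: eq_cobd => t; rewrite ss => -[tn] ts.
(* The induction needs a stronger [C]: the vertices that subdivide a face also stay close to the
   apex [bary s]. *)
apply: (IHn _ _ _ (fun v => C v /\
    forall l, `|v l - bary s l| <= n%:R / n.+1%:R * w) w) => //.
- move=> u u0 uC; split; first by apply: conv => // v /uC[].
  by apply: barycentric_ball => // v /uC[].
- by move=> v /ts vs; split; [exact: sC | move=> l; rewrite -{1}[n]/n.+1.-1 -ss bary_dist].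
- by move=> u v /ts us /ts vs; exact: sw.
move=> u un uC um; apply: cc'; first by rewrite /= un.
  by move=> v; rewrite inE => /orP[/eqP->|/uC[]//]; exact: conv.
have key : n.-1%:R / n%:R * w <= n%:R / n.+1%:R * w.
  apply: ler_wpM2r => //; case: (n) => [|k]; first by rewrite !mul0r.
  by rewrite /= ler_pdivrMr ?ltr0n// mulrAC ler_pdivlMr ?ltr0n// -!natrM ler_nat; lia.
move=> x y; rewrite !inE => /orP[/eqP->|xu] /orP[/eqP->|yu] l /=.
- by rewrite subrr normr0 mulr_ge0// divr_ge0.
- by rewrite distrC; case: (uC _ yu).
- by case: (uC _ xu).
- exact: le_trans (um _ _ xu yu l) key.
Qed.

Lemma iter_sd_local r c c' s C (w : R) : barycentric C ->
  (forall v, v \in s -> C v) -> mesh_le w s ->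
  (forall t, size t = size s -> (forall v, v \in t -> C v) ->
    mesh_le (((size s).-1%:R / (size s)%:R) ^+ r * w) t -> c t = c' t) ->
  iter r sd c s = iter r sd c' s.
Proof.
move=> conv; elim: r s w => [|r IHr] s w sC sw cc' /=.
  by apply: cc' => //; rewrite expr0 mul1r.
apply: (@sdn_local _ _ _ _ C w) => // t ts tC tw.
apply: (IHr _ ((size s).-1%:R / (size s)%:R * w)) => // u.
by rewrite ts => us uC uw; apply: cc' => //; rewrite exprSr -mulrA.
Qed.

(** The mesh tends to 0 under iteration, so cochains need only be compared on small simplices. *)
Lemma iter_sd_eventually c c' s C (w d : R) : 0 < d -> barycentric C ->
  (forall v, v \in s -> C v) -> mesh_le w s ->
  (forall t, size t = size s -> (forall v, v \in t -> C v) ->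
    mesh_le d t -> c t = c' t) ->
  exists r0, forall r, (r0 <= r)%N -> iter r sd c s = iter r sd c' s.
Proof.
move=> d0 conv sC sw cc'.
have [s0|s0] := eqVneq s [::].
  exists 0%N => r _; apply: (iter_sd_local conv sC sw) => t ts tC _.
  apply: cc' => // u v; move: ts; rewrite s0 => /size0nil ->; rewrite in_nil//.
set q := (size s).-1%:R / (size s)%:R : R.
have spos : (0 < size s)%N by case: s s0 {sC sw cc' q}.
have q0 : 0 <= q by rewrite divr_ge0.
have q1 : `|q| < 1.
  by rewrite ger0_norm// ltr_pdivrMr ?ltr0n// mul1r ltr_nat prednK.
have w0 : 0 <= w.
  case: s s0 sw {sC cc' q spos q0 q1} => // v s _ /(_ v v).
  by rewrite mem_head => /(_ isT isT 0%N); rewrite subrr normr0.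
have : (fun r => q ^+ r * w) @ \oo --> 0 * w.
  by apply: cvgMl; exact: cvg_expr.
rewrite mul0r => /cvgrPdist_lt/(_ d d0)[r0 _ rP]; exists r0 => r rr0.
apply: (iter_sd_local conv sC sw) => t ts tC tw; apply: cc' => // u v ut vt l.
apply: (le_trans (tw _ _ ut vt l)); apply: ltW.
have := rP r rr0; rewrite sub0r normrN ger0_norm// mulr_ge0// exprn_ge0//.
Qed.

End Subdivision.

(** * Sperner's lemma on the simplex of monotone sequences *)

Definition complete (T : Type) (n : nat) (lab : T -> nat) (s : seq T) : bool :=
  perm_eq (map lab s) (iota 0 n).

(** The door count of Sperner's lemma: a simplex with a complete face has a second one unless its
    remaining label is new. *)
Lemma cobd_complete (T : Type) n (lab : T -> nat) (s : seq T) :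
  cobd (complete n lab) s =
  has (fun x => (x \notin iota 0 n) && perm_eq (map lab s) (x :: iota 0 n))
    (map lab s).
Proof.
by rewrite -faces_perm_parity ?iota_uniq// faces_map big_map.
Qed.

Section Simplex.
Context {R : realType}.
Notation point := (nat -> R).
Variables (a b : R).

Definition vertex i : point := fun l => if (l <= i)%N then a else b.

Definition simplex m : seq point := map vertex (iota 0 m.+1).

Definition degen i l : nat := if (l <= i)%N then l else l.-1.

Definition in_simplex m (y : point) : Prop :=
  [/\ y 0%N = a, y m.+1 = b & forall l, (l <= m)%N -> y l <= y l.+1].

(** [vertex i] is the only step function that jumps between [i] and [i + 1]; without it the face
    where these coordinates agree is left, and [degen i] parametrizes it. *)
Lemma faces_simplex m : faces (simplex m.+1) =
  map (fun i => map (fun y => y \o degen i) (simplex m)) (iota 0 m.+2).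
Proof.
apply: (@eq_from_nth _ [::]).
  by rewrite size_faces !size_map.
rewrite size_faces size_map size_iota => i im.
rewrite nth_faces ?size_map ?size_iota// (nth_map 0%N) ?size_iota//.
rewrite nth_iota// add0n -map_take -map_drop.
have -> : iota 0 m.+2 = iota 0 i ++ i :: iota i.+1 (m.+1 - i).
  by rewrite -[_ :: _]/(iota i (m.+1 - i).+1) -{2}[i]add0n -iotaD; congr iota; lia.
rewrite take_size_cat ?size_iota// -cat_rcons drop_size_cat ?size_rcons ?size_iota//.
have -> : simplex m = map vertex (iota 0 i) ++ map vertex (iota i (m.+1 - i)).
  by rewrite -map_cat -{3}[i]add0n -iotaD; congr (map _ (iota _ _)); lia.
rewrite map_cat -!map_comp; congr (_ ++ _).
  apply/eq_in_map => j; rewrite mem_iota /= => ji.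
  apply/funext => l; rewrite /vertex /degen /=; case: (leqP l i) => //= il.
  by rewrite !ifF//; lia.
rewrite -[i.+1]addn1 addnC iotaDl -map_comp; apply/eq_in_map => j.
rewrite mem_iota => /andP[ij _]; apply/funext => l; rewrite /vertex /degen /=.
case: (leqP l i) => il; first by rewrite !ifT//; lia.
by congr (if _ then _ else _); lia.
Qed.

Lemma cobd_simplex c m : cobd c (simplex m.+1) =
  \big[addb/false]_(i <- iota 0 m.+2)
     c (map (fun y => y \o degen i) (simplex m)).
Proof. by rewrite /cobd faces_simplex big_map. Qed.

Lemma in_simplex_degen m i y : in_simplex m y -> (i <= m.+1)%N ->
  in_simplex m.+1 (y \o degen i).
Proof.
move=> [y0 ym ymon] im; split=> /=.
- by rewrite /degen.
- by rewrite /degen ifF//; lia.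
move=> l lm; rewrite /degen; case: (leqP l i) => li; case: (leqP l.+1 i) => li' //.
- by apply: ymon; lia.
- by lia.
- by case: l lm {li'} li => // l lm _; apply: ymon.
Qed.

Lemma in_simplex_le m y : in_simplex m y ->
  forall i j, (i <= j)%N -> (j <= m.+1)%N -> y i <= y j.
Proof.
move=> [_ _ ymon] i; elim=> [|j IHj]; first by rewrite leqn0 => /eqP->.
rewrite leq_eqVlt => /orP[/eqP->//|ij] jm.
by apply: (le_trans (IHj _ _)); [lia|lia|apply: ymon].
Qed.

Lemma barycentric_simplex m : barycentric (in_simplex m).
Proof.
move=> s s0 sC.
have s0' : (size s)%:R != 0 :> R by case: s s0 {sC} => // *; rewrite pnatr_eq0.
have cst l x : (forall v, v \in s -> v l = x) -> bary s l = x.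
  move=> H; rewrite /bary (eq_big_seq (fun=> x))// big_const_seq count_predT.
  by rewrite iter_addr_0 -[x *+ _]mulr_natl mulKf.
split; [by apply: cst => v /sC[] | by apply: cst => v /sC[] |].
move=> l lm; rewrite ler_wpM2l ?invr_ge0// !big_seq ler_sum// => v /sC[_ _]; exact.
Qed.

Hypothesis ab : a <= b.

Lemma in_simplex_vertex m v : v \in simplex m -> in_simplex m v.
Proof.
move=> /mapP[i]; rewrite mem_iota add0n => im ->; split=> //.
  by rewrite /vertex ifF//; lia.
by rewrite /vertex => l lm; case: (leqP l i); case: (leqP l.+1 i) => //; lia.
Qed.

Lemma mesh_simplex m : mesh_le (b - a) (simplex m).
Proof.
have ab0 : 0 <= b - a by rewrite subr_ge0.
move=> u v /mapP[i _ ->] /mapP[j _ ->] l; rewrite /vertex.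
case: ifP; case: ifP => _ _; rewrite ?subrr ?normr0//.
  by rewrite distrC ger0_norm.
by rewrite ger0_norm.
Qed.

(** The label [l] is allowed only where the coordinates [l] and [l + 1] differ, so face [i] omits
    label [i]. The count equals that over the boundary, where only the last face remains, and the
    induction applies to it. *)
Lemma sperner m lab r :
  (forall y, in_simplex m y -> (lab y <= m)%N /\ y (lab y) != y (lab y).+1) ->
  iter r sd (complete m.+1 lab) (simplex m).
Proof.
elim: m lab => [|m IHm] lab labP.
  rewrite /simplex /= iter_sd_point /complete /=.
  have [] := labP (vertex 0); first by apply: in_simplex_vertex; rewrite mem_head.
  by rewrite leqn0 => /eqP->.
rewrite (_ : iter _ _ _ _ =
  iter r sd (cobd (complete m.+1 lab)) (simplex m.+1)); last first.
  apply: (iter_sd_local (@barycentric_simplex m.+1) _ (@mesh_simplex m.+1)).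
    exact: in_simplex_vertex.
  move=> t _ tC _; rewrite cobd_complete /complete.
  have -> : perm_eq (map lab t) (iota 0 m.+2) =
      perm_eq (map lab t) (m.+1 :: iota 0 m.+1).
    have /permPr-> // : perm_eq (iota 0 m.+2) (m.+1 :: iota 0 m.+1).
    by rewrite -[m.+2]addn1 iotaD (perm_catC (iota 0 m.+1) [:: m.+1]).
  apply/idP/hasP => [tm|[x /mapP[y yt ->]]].
    by exists m.+1; [rewrite (perm_mem tm) mem_head | rewrite tm mem_iota ltnn].
  rewrite mem_iota /= add0n -leqNgt => /andP[mx].
  suff -> : lab y = m.+1 by [].
  by apply/eqP; rewrite eqn_leq mx; case: (labP y (tC y yt)) => ->.
rewrite iter_sd_cobd cobd_simplex -addn1 iotaD big_cat big_seq1 add0n.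
have omit i y : in_simplex m y -> (i <= m.+1)%N -> lab (y \o degen i) != i.
  move=> yC im; apply/eqP => e.
  have [_] := labP _ (in_simplex_degen yC im).
  by rewrite e /= /degen leqnn ltnn eqxx.
rewrite big1_seq => [|i /andP[_]]; last first.
  rewrite mem_iota add0n => im; rewrite iter_sd_reindex.
  rewrite -[RHS](_ : iter r sd (fun=> false) (simplex m) = false);
    last by rewrite iter_sd0.
  apply: (iter_sd_local (@barycentric_simplex m) _ (@mesh_simplex m)).
    exact: in_simplex_vertex.
  move=> t _ tC _; apply/negbTE/negP => /perm_mem/(_ i).
  rewrite mem_iota im -map_comp => /mapP[y yt /eqP]; apply/negP.
  by rewrite eq_sym omit//; [exact: tC | lia].
rewrite iter_sd_reindex.
have -> : (fun t => complete m.+1 lab (map (fun y => y \o degen m.+1) t)) =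
    complete m.+1 (fun y => lab (y \o degen m.+1)).
  by apply/funext => t; rewrite /complete -map_comp.
apply: IHm => y yC.
have [lm lneq] := labP _ (in_simplex_degen yC (leqnn m.+1)).
have lm' : (lab (y \o degen m.+1) <= m)%N.
  by have := omit m.+1 y yC (leqnn _); lia.
by split=> //; move: lneq; rewrite /= /degen !ifT//; lia.
Qed.

End Simplex.

(** * Labelling finite plane sets by a wide gap *)

Section Labels.
Context {R : realType}.
Notation plane := (R * R)%type.
Variables (eps : R) (m : nat).
Hypothesis eps_gt0 : 0 < eps.
Implicit Types (B : {fset plane}) (z : plane).

Definition gap : R := 2 * eps / m.+1%:R.
Local Notation s := gap.

Definition tau j : R := - eps + j%:R * s.

Lemma gap_gt0 : 0 < s. Proof. by rewrite divr_gt0 ?mulr_gt0. Qed.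

Lemma gap_sum : m.+1%:R * s = 2 * eps.
Proof. by rewrite /gap mulrC divfK ?pnatr_eq0. Qed.

Definition box j z : bool := (0 < z.1) && (`|z.2 - tau j| < s / 4).

Definition hits B : bool := all (fun j => has (box j) (enum_fset B)) (iota 1 m).

Definition height B j : R :=
  if j == 0%N then - eps else if j == m.+1 then eps else
  (nth (0, 0) (enum_fset B) (find (box j) (enum_fset B))).2.

(** The increments of [f] from [- eps] to [eps] have mean [s], so one of them reaches [s]; the first
    such one is chosen. *)
Definition wide (f : nat -> R) : nat :=
  find (fun j => s <= f j.+1 - f j) (iota 0 m.+1).

(* The value [m.+1] marks the sets which are not close to the configuration of the
   [m] points at heights [tau 1, ..., tau m]. *)
Definition label B : nat := if hits B then wide (height B) else m.+1.

Lemma wideP (f : nat -> R) : f 0%N = - eps -> f m.+1 = eps ->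
  (wide f <= m)%N /\ s <= f (wide f).+1 - f (wide f).
Proof.
move=> f0 fm.
have hw : has (fun j => s <= f j.+1 - f j) (iota 0 m.+1).
  apply/hasPn => no; have : \sum_(0 <= j < m.+1) (f j.+1 - f j) < m.+1%:R * s.
    have -> : m.+1%:R * s = \sum_(0 <= j < m.+1) s.
      by rewrite sumr_const_nat subn0 mulr_natl.
    rewrite ltr_sum_nat//.
    by move=> j jm; have := no j; rewrite mem_iota jm => /(_ isT); rewrite -ltNge.
  rewrite telescope_sumr// f0 fm gap_sum; lra.
have := hw; rewrite has_find size_iota ltnS => wm; split=> //.
by have := nth_find 0%N hw; rewrite nth_iota.
Qed.

(** Adding up the increments from the left end bounds [f j] below, and from the right end it bounds
    [f j] above. *)
Lemma near_equispaced (f : nat -> R) (d : R) : f 0%N = - eps -> f m.+1 = eps ->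
  (forall j, (j <= m)%N -> s - d <= f j.+1 - f j) ->
  forall j, (j <= m.+1)%N -> `|f j - tau j| <= m.+1%:R * d.
Proof.
move=> f0 fm fgap.
have lo j : (j <= m.+1)%N -> tau j - j%:R * d <= f j.
  elim: j => [|j IHj] jm; first by rewrite f0 /tau; lra.
  have := fgap j jm; have := IHj (ltnW jm); rewrite /tau -natr1; lra.
have hi j : (j <= m.+1)%N -> f (m.+1 - j)%N <= tau (m.+1 - j)%N + j%:R * d.
  elim: j => [|j IHj] jm; first by rewrite subn0 fm /tau gap_sum; lra.
  have := fgap (m.+1 - j.+1)%N; rewrite leq_subLR addSn addnC ltnS leq_addr => /(_ isT).
  rewrite -subSn// subSS; have := IHj (ltnW jm).
  have -> : tau (m.+1 - j) = tau (m - j)%N + s.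
    by rewrite /tau subSn// -natr1; lra.
  rewrite -(natr1 j); lra.
have d0 : 0 <= m.+1%:R * d.
  have := lo m.+1 (leqnn _); rewrite fm /tau gap_sum; lra.
have d0' : 0 <= d by rewrite -(pmulr_rge0 _ (ltr0Sn R m)).
move=> j jm; rewrite ler_norml.
have := lo j jm; have := hi (m.+1 - j)%N (leq_subr _ _); rewrite subKn//.
have : j%:R * d <= m.+1%:R * d by rewrite ler_wpM2r// ler_nat.
have : (m.+1 - j)%:R * d <= m.+1%:R * d by rewrite ler_wpM2r// ler_nat leq_subr.
by move=> *; apply/andP; split; lra.
Qed.

Lemma boxP B j : hits B -> (0 < j <= m)%N ->
  exists2 z, z \in B & box j z /\ height B j = z.2.
Proof.
move=> /allP/(_ j) Bj jm; have hj := Bj ltac:(rewrite mem_iota; lia).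
exists (nth (0, 0) (enum_fset B) (find (box j) (enum_fset B))).
  by rewrite mem_nth// -has_find.
by split; [exact: nth_find | rewrite /height !ifF//; lia].
Qed.

Lemma tau_inj i j (d : R) : `|tau i - tau j| <= d -> d < s -> i = j.
Proof.
move=> ij ds; apply/eqP; apply: contraT => neq.
suff : s <= `|tau i - tau j| by lra.
have -> : tau i - tau j = (i%:R - j%:R) * s by rewrite /tau; lra.
rewrite normrM (gtr0_norm gap_gt0) ler_peMl ?(ltW gap_gt0)//.
have [ij'|ij'] := leqP i j.
  rewrite distrC -natrB// normr_nat ler1n; lia.
by rewrite -natrB ?(ltnW ij')// normr_nat ler1n; lia.
Qed.

Lemma box_uniq i j z : box i z -> box j z -> i = j.
Proof.
move=> /andP[_ iz] /andP[_ jz]; have s0 := gap_gt0.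
apply: (@tau_inj _ _ (s / 2)); last by lra.
by move: iz jz; rewrite !ltr_norml ler_norml => /andP[? ?] /andP[? ?];
  apply/andP; split; lra.
Qed.

Lemma hits_picks B : hits B -> exists p : nat -> plane,
  [/\ forall j, (0 < j <= m)%N -> box j (p j) /\ height B j = (p j).2,
      uniq (map p (iota 1 m)) &
      {subset map p (iota 1 m) <= [seq z <- enum_fset B | 0 < z.1]}].
Proof.
move=> hB.
have [p pP] : exists p : nat -> plane, forall j, (0 < j <= m)%N ->
    [/\ p j \in B, box j (p j) & height B j = (p j).2].
  exists (fun j => nth (0, 0) (enum_fset B) (find (box j) (enum_fset B))) => j jm.
  have hj : has (box j) (enum_fset B).
    by move/allP: hB => /(_ j); apply; rewrite mem_iota; lia.
  split; [by rewrite mem_nth// -has_find | exact: nth_find |].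
  by rewrite /height !ifF//; lia.
exists p; split; first by move=> j /pP[].
  rewrite map_inj_in_uniq ?iota_uniq// => i j; rewrite !mem_iota => im jm e.
  have [_ bi _] := pP i ltac:(lia); have [_ bj _] := pP j ltac:(lia).
  by apply: (box_uniq bi); rewrite e.
move=> _ /mapP[j jm ->]; rewrite mem_iota in jm.
have [pB /andP[p0 _] _] := pP j ltac:(lia).
by rewrite mem_filter p0.
Qed.

Lemma hits_count B : hits B ->
  (m <= count (fun z => (0 < z.1)%R) (enum_fset B))%N.
Proof.
move=> /hits_picks[p [_ pu /(uniq_leq_size pu)]].
by rewrite size_map size_iota size_filter.
Qed.

Definition thin B : bool := (count (fun z => (0 < z.1)%R) (enum_fset B) <= m)%N.

(** The [m] disjoint boxes each hold a point, and at most [m] points lie on the right, so none of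
    them is outside the boxes. *)
Lemma thin_boxP B z : thin B -> hits B -> z \in B -> 0 < z.1 ->
  exists j, [/\ (0 < j <= m)%N, box j z & height B j = z.2].
Proof.
move=> tB /hits_picks[p [pP pu sub]] zB z0.
have [_ e] := uniq_min_size pu sub ltac:(by rewrite size_map size_iota size_filter).
have : z \in map p (iota 1 m) by rewrite e mem_filter z0.
move=> /mapP[j jm ze]; rewrite mem_iota in jm.
by have [bj hj] := pP j ltac:(lia); exists j; rewrite ze; split=> //; lia.
Qed.

Lemma label_le B : (label B <= m)%N = hits B.
Proof.
rewrite /label; case: ifP => [_|_]; last by rewrite ltnn.
by have [] := @wideP (height B) erefl ltac:(by rewrite /height eqxx).
Qed.

Lemma label_wide B : hits B ->
  s <= height B (label B).+1 - height B (label B).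
Proof.
rewrite /label => ->.
by have [] := @wideP (height B) erefl ltac:(by rewrite /height eqxx).
Qed.

Definition away B : Prop :=
  forall z, z \in B -> (2 * eps) ^+ 2 <= z.1 ^+ 2 + z.2 ^+ 2.

Definition near_set (d : R) B B' : Prop := forall z, z \in B ->
  exists2 z', z' \in B' & `|z.1 - z'.1| <= d /\ `|z.2 - z'.2| <= d.

Lemma tau_bound j : (0 < j <= m)%N -> - eps + s <= tau j <= eps - s.
Proof.
move=> jm; have s0 := gap_gt0; have := gap_sum.
have j1 : 1 <= j%:R :> R by rewrite ler1n; lia.
have jm' : j%:R <= m%:R :> R by rewrite ler_nat; lia.
rewrite -natr1 /tau => e; apply/andP; split; nra.
Qed.

Lemma gap_le : s <= 2 * eps.
Proof.
by rewrite -gap_sum ler_peMl ?ler1n// (ltW gap_gt0).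
Qed.

(** In a box the second coordinate is at most [eps] in modulus, so a distance of [2 * eps] from the
    origin forces [eps <= z.1]. *)
Lemma right_persists B z z' j (d : R) : away B -> z \in B -> (0 < j <= m)%N ->
  box j z -> `|z.1 - z'.1| <= d -> d < eps -> 0 < z'.1.
Proof.
move=> aB zB jm /andP[z0 zj]; rewrite ler_norml => /andP[d1 d2] de.
have := aB z zB; have := tau_bound jm; have s0 := gap_gt0.
move: zj; rewrite ltr_norml => /andP[? ?] /andP[? ?] zz.
have z2 : z.2 ^+ 2 <= eps ^+ 2.
  have h1 : 0 <= eps - z.2 by lra.
  have h2 : 0 <= eps + z.2 by lra.
  by have := mulr_ge0 h1 h2; nra.
suff : eps <= z.1 by lra.
by rewrite -(@ler_pXn2r _ 2) ?nnegrE ?ltW//; nra.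
Qed.

(** The partner of a boxed point stays on the right, so thinness puts it in some box, necessarily
    the one with the same index. *)
Lemma height_near B B' (d : R) : hits B -> hits B' -> thin B' -> away B ->
  near_set d B B' -> 0 <= d <= s / 8 ->
  forall j, (j <= m.+1)%N -> `|height B j - height B' j| <= d.
Proof.
move=> hB hB' tB' aB near /andP[d0 ds] j jm; have s0 := gap_gt0; have s2 := gap_le.
have [->|j0] := posnP j; first by rewrite /height eqxx subrr normr0.
have [->|jm1] := eqVneq j m.+1; first by rewrite /height eqxx subrr normr0.
have jm' : (0 < j <= m)%N by lia.
have [z zB [bz ->]] := boxP hB jm'.
have [z' zB' [z1 z2]] := near z zB.
have z'0 : 0 < z'.1 by apply: (right_persists aB zB jm' bz z1); lra.
have [j' [jm'' bz' e]] := thin_boxP tB' hB' zB' z'0.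
suff <- : j' = j by rewrite e.
(* The tolerance is [s / 4 + s / 4 + s / 8], for the two boxes and for [d]. *)
apply: (@tau_inj _ _ (5 / 8 * s)); last lra.
move: bz bz' z2 => /andP[_] + /andP[_]; rewrite !ltr_norml !ler_norml.
by move=> /andP[? ?] /andP[? ?] /andP[? ?]; apply/andP; split; lra.
Qed.

(** The label [j] certifies an increment of at least [s] for one of the sets, and closeness passes
    it on to [B] with a loss of [2 * d]. *)
Lemma height_equispaced (t : seq {fset plane}) (d : R) : 0 <= d <= s / 8 ->
  (forall B, B \in t -> thin B /\ away B) ->
  (forall B B', B \in t -> B' \in t -> near_set d B B') ->
  (forall j, (j <= m)%N -> exists2 B, B \in t & label B = j) ->
  forall B j, B \in t -> hits B -> (j <= m.+1)%N ->
  `|height B j - tau j| <= m.+1%:R * (2 * d).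
Proof.
move=> ds tP near lab B j Bt hB; apply: near_equispaced => //.
  by rewrite /height eqxx.
move=> {}j jm; have [B' B't lB'] := lab j jm.
have hB' : hits B' by rewrite -label_le lB'.
have := label_wide hB'; rewrite lB'.
have [tB aB] := tP B Bt; have [tB' aB'] := tP B' B't.
have close := height_near hB hB' tB' aB (near _ _ Bt B't) ds.
have := close j (leqW jm); have := close j.+1 jm; rewrite !ler_norml.
by move=> /andP[? ?] /andP[? ?]; lra.
Qed.

(** The count of complete labels is a cocycle on small simplices. If [0, ..., m] all occur, the
    heights are nearly equispaced, so every nearby set still hits all boxes and cannot carry the
    label [m + 1]. *)
Lemma cobd_label (t : seq {fset plane}) (d : R) :
  0 <= d -> m.+1%:R * (2 * d) + d < s / 4 ->
  (forall B, B \in t -> thin B /\ away B) ->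
  (forall B B', B \in t -> B' \in t -> near_set d B B') ->
  cobd (complete m.+1 label) t = false.
Proof.
move=> d0 dlt tP near; have s0 := gap_gt0; have s2 := gap_le.
have ds : 0 <= d <= s / 8.
  have : 1 * (2 * d) <= m.+1%:R * (2 * d) by rewrite ler_wpM2r ?ler1n//; lra.
  by move=> ?; apply/andP; split; lra.
rewrite cobd_complete; apply/negbTE/hasPn => _ /mapP[B0 B0t ->].
apply/negP; rewrite mem_iota leq0n add0n -leqNgt => /andP[mB0 /perm_mem labs].
have lab j : (j <= m)%N -> exists2 B, B \in t & label B = j.
  move=> jm; have : j \in map label t by rewrite labs inE mem_iota ltnS jm orbT.
  by move=> /mapP[B Bt ->]; exists B.
have [B Bt lB] := lab 0%N isT.
have hB : hits B by rewrite -label_le lB.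
suff : hits B0 by rewrite -label_le leqNgt mB0.
apply/allP => j; rewrite mem_iota => jm.
have jm' : (0 < j <= m)%N by lia.
have [z zB [bz e]] := boxP hB jm'.
have := height_equispaced ds tP near lab (j := j) Bt hB ltac:(lia).
have [z' z'B0 [z1 z2]] := near B B0 Bt B0t z zB.
have [_ aB] := tP B Bt.
have z'0 : 0 < z'.1.
  by apply: (right_persists aB zB jm' bz z1); move: ds => /andP[? ?]; lra.
rewrite e => zt; apply/hasP; exists z' => //; rewrite /box z'0 /=.
move: zt z2; rewrite ltr_norml !ler_norml => /andP[? ?] /andP[? ?].
by apply/andP; split; lra.
Qed.

End Labels.

(** * Chords of the unit circle and truncated sine *)

Section Circle.
Context {R : realType}.
Notation plane := (R * R)%type.

Definition expi (x : R) : plane := (cos x, sin x).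

Lemma abs_sin_le (x : R) : `|sin x| <= `|x|.
Proof.
have [c _ e] : exists2 c, c \in `[0, `|x|] & sin `|x| - sin 0 = cos c * (`|x| - 0).
  apply: MVT_segment => //.
  by apply/continuous_subspaceT => ?; exact: continuous_sin.
have -> : `|sin x| = `|sin `|x| |.
  by case: (ger0P x) => _; rewrite ?sinN ?normrN.
move: e; rewrite sin0 !subr0 => ->; rewrite normrM normr_id.
by rewrite ler_piMl// cos_max.
Qed.

Lemma expi_chord (x y : R) :
  (cos x - cos y) ^+ 2 + (sin x - sin y) ^+ 2 <= (x - y) ^+ 2.
Proof.
have -> : (cos x - cos y) ^+ 2 + (sin x - sin y) ^+ 2 = 2 - 2 * cos (x - y).
  rewrite cosB; have := cos2Dsin2 x; have := cos2Dsin2 y; nra.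
have -> : cos (x - y) = 1 - 2 * sin ((x - y) / 2) ^+ 2.
  rewrite {1}(splitr (x - y)) -mulr2n cos_mulr2n cos2sin2; lra.
have : sin ((x - y) / 2) ^+ 2 <= ((x - y) / 2) ^+ 2.
  by rewrite -real_normK ?num_real// -[leRHS]real_normK ?num_real// lerXn2r
    ?nnegrE// abs_sin_le.
lra.
Qed.

Lemma expi_dist (x y d : R) : `|x - y| <= d ->
  `|(expi x).1 - (expi y).1| <= d /\ `|(expi x).2 - (expi y).2| <= d.
Proof.
move=> xyd; have d0 : 0 <= d by exact: le_trans xyd.
have sq (u : R) : u ^+ 2 <= (x - y) ^+ 2 -> `|u| <= d.
  move=> h; apply: le_trans xyd; rewrite -(@ler_pXn2r _ 2) ?nnegrE//.
  by rewrite !real_normK ?num_real.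
have := expi_chord x y; split; apply: sq => /=.
  by have := sqr_ge0 (sin x - sin y); lra.
by have := sqr_ge0 (cos x - cos y); lra.
Qed.

Definition clip (c x : R) : R := Num.max (- c) (Num.min x c).

Lemma clip_dist c x y : `|clip c x - clip c y| <= `|x - y|.
Proof.
rewrite /clip !maxEle !minEle.
do !case: ifPn; rewrite -?ltNge => *; rewrite ?subrr ?normr0//;
  rewrite ler_norml; apply/andP; split; case: (ger0P (x - y)) => *; lra.
Qed.

Lemma clip_id c x : `|x| <= c -> clip c x = x.
Proof.
rewrite ler_norml => /andP[x1 x2].
by rewrite /clip (min_idPl x2) (max_idPr x1).
Qed.

Lemma clip_ge c x : 0 <= c -> c <= x -> clip c x = c.
Proof. by move=> c0 cx; rewrite /clip (min_idPr cx); apply/max_idPr; lra. Qed.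

Lemma clip_le c x : 0 <= c -> x <= - c -> clip c x = - c.
Proof.
move=> c0 cx; rewrite /clip; apply/max_idPl.
by rewrite ge_min cx.
Qed.

(* Equals [sin x] where [expi x] is close to [(1, 0)], and is locally constant
   elsewhere. *)
Definition profile (eps x : R) : R := clip eps (sin (clip (pi / 2) x)).

Lemma profile_dist eps x y : `|profile eps x - profile eps y| <= `|x - y|.
Proof.
rewrite (le_trans (clip_dist _ _ _))// (le_trans _ (clip_dist (pi / 2) x y))//.
by case: (@expi_dist (clip (pi / 2) x) (clip (pi / 2) y) _ (lexx _)).
Qed.

Lemma profile_pi eps : 0 < eps <= 1 ->
  profile eps (- pi) = - eps /\ profile eps pi = eps.
Proof.
move=> /andP[e0 e1]; have p0 := pi_gt0 R; rewrite /profile; split.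
  by rewrite (@clip_le (pi / 2)); [rewrite sinN sin_pihalf clip_le; lra|lra|lra].
by rewrite (@clip_ge (pi / 2)); [rewrite sin_pihalf clip_ge; lra|lra|lra].
Qed.

(** A value below [eps] in modulus excludes both truncations, the inner one because the sine has
    modulus 1 at its ends. *)
Lemma profile_sin eps x : 0 < eps <= 1 -> `|profile eps x| < eps ->
  profile eps x = sin x /\ 0 < cos x.
Proof.
move=> /andP[e0 e1] xe; have p0 := pi_gt0 R.
have [xlo|xlo] := leP x (- (pi / 2)).
  move: xe; rewrite /profile (@clip_le (pi / 2)) ?sinN ?sin_pihalf; [|lra|lra].
  by rewrite clip_le ?normrN ?gtr0_norm ?ltxx//; lra.
have [xhi|xhi] := leP (pi / 2) x.
  move: xe; rewrite /profile (@clip_ge (pi / 2)) ?sin_pihalf; [|lra|lra].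
  by rewrite clip_ge ?gtr0_norm ?ltxx//; lra.
split; last by rewrite cos_gt0_pihalf// xlo xhi.
move: xe; rewrite /profile (@clip_id (pi / 2)) ?ler_norml ?(ltW xlo) ?(ltW xhi)//.
have [h|h] := leP `|sin x| eps; first by rewrite clip_id.
move: h; rewrite ltr_normr => /orP[h|h].
  by rewrite clip_ge ?ltW// gtr0_norm// ltxx.
by rewrite clip_le ?normrN ?gtr0_norm ?ltxx ?ltW//; lra.
Qed.

Lemma cos_gt0_bounds (x : R) : - pi <= x <= pi -> 0 < cos x ->
  - (pi / 2) < x < pi / 2.
Proof.
move=> /andP[x1 x2] cx; have p0 := pi_gt0 R.
apply/andP; split; rewrite ltNge; apply/negP => h; suff : cos x <= 0 by lra.
  have : 0 <= sin (- x - pi / 2) by apply: sin_ge0_pi; lra.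
  by rewrite sinBpihalf cosN; lra.
have : 0 <= sin (x - pi / 2) by apply: sin_ge0_pi; lra.
by rewrite sinBpihalf; lra.
Qed.

Lemma profile_eq_sin eps x : 0 < eps <= 1 -> - pi <= x <= pi -> 0 < cos x ->
  `|sin x| <= eps -> profile eps x = sin x.
Proof.
move=> /andP[e0 e1] xpi cx sx; have p0 := pi_gt0 R.
have /andP[xlo xhi] := cos_gt0_bounds xpi cx.
by rewrite /profile (@clip_id (pi / 2)) ?clip_id// ler_norml (ltW xlo) (ltW xhi).
Qed.

Lemma sin_le_mono (x y : R) : - pi <= x <= pi -> - pi <= y <= pi ->
  0 < cos x -> 0 < cos y -> x <= y -> sin x <= sin y.
Proof.
move=> xpi ypi cx cy; rewrite le_eqVlt => /orP[/eqP->//|xy].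
have /andP[x1 x2] := cos_gt0_bounds xpi cx.
have /andP[y1 y2] := cos_gt0_bounds ypi cy.
by rewrite ltW// ltr_sin// in_itv/=; lra.
Qed.

End Circle.

(** * The count where the points on the right are the parametrized ones *)

Lemma strictly_mono_id m (f : nat -> nat) :
  (forall j, (0 < j <= m)%N -> (0 < f j <= m)%N) ->
  (forall i j, (0 < i)%N -> (i < j)%N -> (j <= m)%N -> (f i < f j)%N) ->
  forall j, (0 < j <= m)%N -> f j = j.
Proof.
move=> fr fm.
have lo j : (0 < j <= m)%N -> (j <= f j)%N.
  elim: j => // j IHj jm; have [j0|j0] := posnP j; first by have := fr _ jm; lia.
  by have := fm j j.+1 j0 (ltnSn _) ltac:(lia); have := IHj ltac:(lia); lia.
have hi d : (d < m)%N -> (f (m - d) <= m - d)%N.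
  elim: d => [|d IHd] dm; first by rewrite subn0; have := fr m; lia.
  by have := fm (m - d.+1)%N (m - d)%N ltac:(lia) ltac:(lia) ltac:(lia);
    have := IHd ltac:(lia); lia.
move=> j jm; have := lo j jm; have := hi (m - j)%N ltac:(lia).
by rewrite subKn; lia.
Qed.

Section Identity.
Context {R : realType}.
Notation plane := (R * R)%type.
Variables (eps : R) (m : nat) (F : (nat -> R) -> {fset plane}).
Hypothesis eps01 : 0 < eps <= 1.
Hypothesis F_right : forall y : nat -> R, in_simplex (- pi) pi m y ->
  forall z : plane, 0 < z.1 ->
  z \in F y <-> exists2 i, (0 < i <= m)%N & z = expi (y i).

Let eps_gt0 : 0 < eps. Proof. by case/andP: eps01. Qed.

Let pi_bounds (y : nat -> R) i : in_simplex (- pi) pi m y -> (i <= m.+1)%N ->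
  - pi <= y i <= pi.
Proof.
move=> yC im; case: (yC) => y0 ym _.
by rewrite -y0 -ym !(in_simplex_le yC).
Qed.

(** Each box [k] contains some [expi (y i)]. The sine increases on the right half circle and the
    boxes are ordered by height, so [i] is a strictly increasing function of [k] on [1, ..., m],
    hence the identity. *)
Lemma height_expi y j : in_simplex (- pi) pi m y -> hits eps m (F y) ->
  (j <= m.+1)%N -> height eps m (F y) j = profile eps (y j).
Proof.
move=> yC hy jm; case: (yC) => y0 ym _; have [pN pP] := profile_pi eps01.
have [->|j0] := posnP j; first by rewrite y0 pN /height eqxx.
have [->|jm1] := eqVneq j m.+1; first by rewrite ym pP /height eqxx.
have s0 := gap_gt0 m eps_gt0.
have /choice[f fP] : forall j, exists i, (0 < j <= m)%N ->
    [/\ (0 < i <= m)%N, box eps m j (expi (y i)) &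
      height eps m (F y) j = sin (y i)].
  move=> k; have [km|] := boolP (0 < k <= m)%N; last by exists 0%N.
  have [z zF [bz e]] := boxP eps_gt0 hy km.
  have z0 : 0 < z.1 by case/andP: bz.
  have [i im ze] := (F_right yC z0).1 zF; exists i => _.
  by split=> //; [rewrite -ze | rewrite e ze].
have f_id : forall k, (0 < k <= m)%N -> f k = k.
  apply: strictly_mono_id => [k /fP[]//|i k i0 ik km].
  have [fi bi _] := fP i ltac:(lia); have [fk bk _] := fP k ltac:(lia).
  rewrite ltnNge; apply/negP => fki.
  have : sin (y (f k)) <= sin (y (f i)).
    move: bi bk => /andP[ci _] /andP[ck _].
    apply: sin_le_mono; [apply: (pi_bounds yC); lia | apply: (pi_bounds yC); lia
      | exact: ck | exact: ci |].
    by apply: (in_simplex_le yC); lia.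
  have : tau eps m k - tau eps m i >= gap eps m.
    rewrite /tau; have : i%:R + 1 <= k%:R :> R by rewrite natr1 ler_nat.
    by move=> ?; nra.
  move: bi bk => /andP[_] + /andP[_]; rewrite !ltr_norml /=.
  by move=> /andP[? ?] /andP[? ?]; lra.
have jm' : (0 < j <= m)%N by lia.
have [_ /andP[/= cj bj] ->] := fP j jm'; rewrite (f_id j jm') in cj bj *.
rewrite profile_eq_sin//; first exact: (pi_bounds yC).
have /andP[? ?] := tau_bound eps_gt0 jm'.
by move: bj; rewrite ltr_norml ler_norml => /andP[? ?]; apply/andP; split; lra.
Qed.

Lemma label_expi y : in_simplex (- pi) pi m y -> hits eps m (F y) ->
  label eps m (F y) = wide eps m (profile eps \o y).
Proof.
move=> yC hy; rewrite /label hy /wide; apply: eq_in_find => j.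
by rewrite mem_iota => jm; rewrite /= !height_expi//; lia.
Qed.

(** On small simplices [label] may be replaced by [wide (profile eps \o y)], which is defined even
    where a box is missed and satisfies Sperner's condition. *)
Lemma identity_count : exists r0, forall r, (r0 <= r)%N ->
  iter r sd (complete m.+1 (label eps m \o F)) (simplex (- pi) pi m).
Proof.
have s0 := gap_gt0 m eps_gt0; have [pN pP] := profile_pi eps01.
have Npi : - pi <= pi :> R by have := pi_gt0 R; lra.
pose lab y := wide eps m (profile eps \o y).
have labP y : in_simplex (- pi) pi m y -> (lab y <= m)%N /\
    gap eps m <= profile eps (y (lab y).+1) - profile eps (y (lab y)).
  by move=> [y0 ym _]; apply: wideP => //=; rewrite ?y0 ?ym.
(* With this [d], increments accurate to [2 * d] give heights accurate to an eighth of the gap. *)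
pose d := gap eps m / (16 * m.+1%:R).
have d0 : 0 < d by rewrite divr_gt0// mulr_gt0.
have dE : m.+1%:R * (2 * d) = gap eps m / 8.
  by rewrite /d; field; rewrite addrC natr1 pnatr_eq0.
suff [r0 r0P] : exists r0, forall r, (r0 <= r)%N ->
    iter r sd (complete m.+1 (label eps m \o F)) (simplex (- pi) pi m) =
    iter r sd (complete m.+1 lab) (simplex (- pi) pi m).
  exists r0 => r /r0P ->; apply: sperner => // y yC.
  have [lm lw] := labP y yC; split=> //; apply/eqP => e.
  by move: lw; rewrite -e subrr; lra.
apply: (iter_sd_eventually d0 (barycentric_simplex (a := - pi) (b := pi) (m := m)) _
  (mesh_simplex Npi (m := m))); first exact: in_simplex_vertex.
move=> t _ tC tm.
(* The labels agree once all boxes are hit, and completeness for either label implies that. *)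
have agree : (forall y, y \in t -> hits eps m (F y)) ->
    complete m.+1 (label eps m \o F) t = complete m.+1 lab t.
  move=> ht; rewrite /complete; congr perm_eq; apply/eq_in_map => y yt /=.
  by rewrite label_expi//; [exact: tC | exact: ht].
apply/idP/idP => [c|c]; first rewrite -agree// => y yt.
  have : label eps m (F y) \in iota 0 m.+1.
    by rewrite -(perm_mem c); apply/mapP; exists y.
  by rewrite mem_iota add0n ltnS label_le.
rewrite agree// => y yt; have yC := tC y yt; case: (yC) => y0 ym _.
have near j : (j <= m.+1)%N ->
    `|profile eps (y j) - tau eps m j| <= m.+1%:R * (2 * d).
  move: j; apply: (near_equispaced (f := fun j => profile eps (y j))).
  - by rewrite y0.
  - by rewrite ym.
  move=> j jm; have : j \in map lab t by rewrite (perm_mem c) mem_iota.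
  move=> /mapP[u ut ju]; have [_] := labP u (tC u ut); rewrite -ju => uw.
  have := le_trans (profile_dist eps _ _) (tm u y ut yt j).
  have := le_trans (profile_dist eps _ _) (tm u y ut yt j.+1).
  by rewrite !ler_norml => /andP[? ?] /andP[? ?]; lra.
apply/allP => j; rewrite mem_iota => jm; have jm' : (0 < j <= m)%N by lia.
have := near j ltac:(lia); rewrite dE => nj.
have /andP[? ?] := tau_bound eps_gt0 jm'.
have [e cj] : profile eps (y j) = sin (y j) /\ 0 < cos (y j).
  apply: profile_sin => //; move: nj; rewrite ler_norml ltr_norml.
  by move=> /andP[? ?]; apply/andP; split; lra.
apply/hasP; exists (expi (y j)).
  by apply/(F_right yC) => //; exists j.
by rewrite /box /= cj -e (le_lt_trans nj)//; lra.
Qed.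

End Identity.

(** * Vanishing of the count over the boundary *)

Section DegreeArgument.
Context {R : realType}.
Notation plane := (R * R)%type.
Variables (eps : R) (m : nat).
Hypothesis eps01 : 0 < eps <= 1.
Let Npi : - pi <= pi :> R. Proof. by have := pi_gt0 R; lra. Qed.
Let eps_gt0 : 0 < eps. Proof. by case/andP: eps01. Qed.

Lemma missing_count (F : (nat -> R) -> {fset plane}) r :
  (forall y : nat -> R, in_simplex (- pi) pi m y -> ~~ hits eps m (F y)) ->
  iter r sd (complete m.+1 (label eps m \o F)) (simplex (- pi) pi m) = false.
Proof.
move=> nh; transitivity (iter r sd (fun=> false) (simplex (- pi : R) pi m));
  last by rewrite iter_sd0.
apply: (@iter_sd_local R r _ _ _ (in_simplex (- pi) pi m) (pi - - pi)).
- exact: barycentric_simplex.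
- exact: in_simplex_vertex.
- exact: mesh_simplex.
move=> t _ tC _; apply/negbTE/negP => c.
have : 0%N \in iota 0 m.+1 by rewrite mem_iota.
rewrite -(perm_mem c) => /mapP[y yt /= l0].
by have := nh y (tC y yt); rewrite -label_le -l0.
Qed.

(** The coboundary of the count vanishes on small simplices, so it sums to 0 over fine subdivisions.
    As subdivision commutes with the coboundary, this sum is the one over the faces. *)
Lemma faces_count (F : (nat -> R) -> {fset plane}) (L : R) : 0 <= L ->
  (forall x : nat -> R, in_simplex (- pi) pi m.+1 x ->
    thin m (F x) /\ away eps (F x)) ->
  (forall (x y : nat -> R) d, in_simplex (- pi) pi m.+1 x ->
    in_simplex (- pi) pi m.+1 y -> (forall l, `|x l - y l| <= d) ->
    near_set (L * d) (F x) (F y)) ->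
  exists r0, forall r, (r0 <= r)%N ->
    \big[addb/false]_(i <- iota 0 m.+2)
      iter r sd (complete m.+1 (label eps m \o (fun y => F (y \o degen i))))
        (simplex (- pi) pi m) = false.
Proof.
move=> L0 FP Fnear; have s0 := gap_gt0 m eps_gt0.
(* Makes the left side of [Ld] at most an eighth of the gap; [L + 1] keeps [K] positive for
   [L = 0]. *)
pose K := 4 * (2 * m.+1%:R + 1) * (L + 1).
have K0 : 0 < K by rewrite !mulr_gt0//; have := ltr0Sn R m; lra.
pose d := gap eps m / (2 * K).
have d0 : 0 < d by rewrite divr_gt0//; lra.
have Ld : m.+1%:R * (2 * (L * d)) + L * d < gap eps m / 4.
  have dE : K * d = gap eps m / 2 by rewrite /d; field; apply: lt0r_neq0.
  have : (4 * (2 * m.+1%:R + 1) * L) * d <= K * d.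
    rewrite ler_wpM2r ?(ltW d0)// /K ler_wpM2l//; have := ltr0Sn R m; lra.
  rewrite dE; lra.
have [r0 r0P] := @iter_sd_eventually R (cobd (complete m.+1 (label eps m \o F)))
  (fun=> false) (simplex (- pi) pi m.+1) (in_simplex (- pi) pi m.+1) (pi - - pi) d d0
  (@barycentric_simplex R (- pi) pi m.+1)
  (@in_simplex_vertex _ _ _ Npi m.+1) (mesh_simplex Npi (m := m.+1))
  ltac:(move=> t _ tC tm;
    rewrite (_ : cobd _ t = cobd (complete m.+1 (label eps m)) (map F t));
      [|by rewrite /cobd faces_map big_map; apply: eq_bigr => u _;
         rewrite /complete -map_comp];
    apply: (cobd_label eps_gt0 (d := L * d));
      [by rewrite mulr_ge0// ltW | exact: Ld
      |by move=> _ /mapP[y yt ->]; exact/FP/tC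
      |move=> _ _ /mapP[y yt ->] /mapP[u ut ->];
       by apply: Fnear; [exact: tC|exact: tC|exact: tm]]).
exists r0 => r /r0P; rewrite iter_sd0 iter_sd_cobd cobd_simplex; apply: etrans.
apply: eq_bigr => i _; rewrite iter_sd_reindex; congr (iter r sd _ _).
by apply/funext => t; rewrite /complete -map_comp.
Qed.

End DegreeArgument.

Lemma eventually_all (N : nat) (P : nat -> nat -> Prop) :
  (forall i, (i < N)%N -> exists r0, forall r, (r0 <= r)%N -> P i r) ->
  exists r0, forall r, (r0 <= r)%N -> forall i, (i < N)%N -> P i r.
Proof.
elim: N => [|N IHN] iP; first by exists 0%N.
have [r1 r1P] := IHN (fun i iN => iP i (ltnW iN)).
have [r2 r2P] := iP N (ltnSn N).
exists (maxn r1 r2) => r; rewrite geq_max => /andP[r1r r2r] i.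
by rewrite ltnS leq_eqVlt => /orP[/eqP->|iN]; [exact: r2P | exact: r1P].
Qed.

(** * Circle sets and merging of points *)

Section CircleSets.
Context {R : realType}.
Notation plane := (R * R)%type.
Implicit Types (A B C : {fset plane}).

Definition sqdist (z w : plane) : R := (z.1 - w.1) ^+ 2 + (z.2 - w.2) ^+ 2.

Definition within_dist (d : R) A B : Prop :=
  forall z, z \in A -> exists2 w, w \in B & sqdist z w <= d ^+ 2.

Lemma within_dist_near d A B : 0 <= d -> within_dist d A B -> near_set d A B.
Proof.
move=> d0 AB z /AB[w wB zw]; exists w => //; move: zw; rewrite /sqdist => zw.
have sq (u : R) : u ^+ 2 <= d ^+ 2 -> `|u| <= d.
  by move=> ud; rewrite -(@ler_pXn2r _ 2) ?nnegrE// real_normK ?num_real.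
by have := sqr_ge0 (z.1 - w.1); have := sqr_ge0 (z.2 - w.2); split; apply: sq; lra.
Qed.

Lemma sqdist_expi (x y d : R) : `|x - y| <= d -> sqdist (expi x) (expi y) <= d ^+ 2.
Proof.
move=> xy; apply: (le_trans (expi_chord x y)).
by rewrite -real_normK ?num_real// lerXn2r ?nnegrE// (le_trans _ xy).
Qed.

Definition circle_set (s : seq R) : {fset plane} := seq_fset tt (map expi s).

Lemma mem_circle_set s z : (z \in circle_set s) = (z \in map expi s).
Proof. exact: seq_fsetE. Qed.

Lemma card_circle_set s : (#|` circle_set s| <= size s)%N.
Proof. by rewrite size_seq_fset (leq_trans (size_undup _)) ?size_map. Qed.

Lemma circle_set_neq0 x s : circle_set (x :: s) != fset0.
Proof. by apply/fset0Pn; exists (expi x); rewrite mem_circle_set mem_head. Qed.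

Lemma expiD2pi (x : R) : expi (x + 2 * pi) = expi x.
Proof. by rewrite /expi mulr_natl cosD2pi sinD2pi. Qed.

(* Replacing two adjacent points with the smallest gap by the midpoint of the
   arc between them. *)
Lemma merge_adjacent k (x : nat -> R) : (0 < k)%N ->
  (forall i, (i < k)%N -> x i <= x i.+1) -> x k <= x 0%N + 2 * pi ->
  exists C, [/\ C != fset0, (#|` C| <= k)%N,
    forall z, z \in C -> z.1 ^+ 2 + z.2 ^+ 2 = 1,
    within_dist (pi / k.+1%:R) (circle_set (map x (iota 0 k.+1))) C &
    within_dist (pi / k.+1%:R) C (circle_set (map x (iota 0 k.+1)))].
Proof.
move=> k0 xmon xk; have p0 := pi_gt0 R.
(* The cyclic gaps, the last one leading from [x k] round to [x 0]. They add up to [2 * pi], so some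
   half gap is at most [pi / k.+1]. *)
pose g i := (if i == k then x 0%N + 2 * pi else x i.+1) - x i.
have g0 i : (i <= k)%N -> 0 <= g i.
  by rewrite /g => ik; case: eqVneq => [->|ne]; rewrite subr_ge0// xmon; lia.
have gsum : \sum_(0 <= i < k.+1) g i = 2 * pi.
  rewrite big_nat_recr//= {2}/g eqxx.
  rewrite (eq_big_nat _ _ (F2 := fun i => x i.+1 - x i)); last first.
    by move=> i ik; rewrite /g ifF//; lia.
  by rewrite telescope_sumr//; lra.
have [j jk gj] : exists2 j, (j <= k)%N & g j / 2 <= pi / k.+1%:R.
  apply: contrapT => no.
  have : \sum_(0 <= i < k.+1) (2 * (pi / k.+1%:R)) < \sum_(0 <= i < k.+1) g i.
    apply: ltr_sum_nat => // i ik; rewrite ltNge; apply/negP => gi; apply: no.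
    by exists i => //; rewrite ler_pdivrMr// mulrC.
  rewrite gsum sumr_const_nat subn0.
  by rewrite -[ltLHS]mulr_natr -mulrA divfK ?ltxx// pnatr_eq0.
pose nx := if j == k then 0%N else j.+1.
have nxk : (nx <= k)%N by rewrite /nx; case: eqVneq => jk'; lia.
have nxj : nx != j.
  by rewrite /nx neq_ltn; case: eqVneq => [->|_]; rewrite ?k0// ltnSn orbT.
have nxE : expi (x nx) = expi (x j + g j).
  rewrite /g /nx addrC subrK; case: eqP => // _.
  by rewrite expiD2pi.
have D0 : 0 <= pi / k.+1%:R :> R by rewrite divr_ge0// ltW.
set I := rem j (rem nx (iota 0 k.+1)).
have memI i : (i \in I) = [&& i != j, i != nx & (i <= k)%N].
  by rewrite mem_rem_uniq ?rem_uniq ?iota_uniq// inE mem_rem_uniq ?iota_uniq// inE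
    mem_iota.
have sizeI : size I = k.-1.
  rewrite size_rem ?mem_rem_uniq ?iota_uniq//.
    by rewrite size_rem ?size_iota// mem_iota.
  by rewrite inE eq_sym nxj mem_iota.
exists (circle_set (x j + g j / 2 :: map x I)); split.
- exact: circle_set_neq0.
- by rewrite (leq_trans (card_circle_set _))//= size_map sizeI; lia.
- by move=> z; rewrite mem_circle_set => /mapP[y _ ->]; exact: cos2Dsin2.
- move=> z; rewrite mem_circle_set -map_comp => /mapP[i]; rewrite mem_iota add0n => ik ->.
  have := g0 j jk => gj0.
  have [->|ij] := eqVneq i j.
    exists (expi (x j + g j / 2)); first by rewrite mem_circle_set mem_head.
    by apply: sqdist_expi; rewrite opprD addrA subrr sub0r normrN ger0_norm//; lra.
  have [->|inx] := eqVneq i nx.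
    exists (expi (x j + g j / 2)); first by rewrite mem_circle_set mem_head.
    rewrite /= nxE; apply: sqdist_expi.
    by rewrite (_ : _ - _ = g j / 2) ?ger0_norm//; lra.
  exists (expi (x i)).
    rewrite mem_circle_set /= inE; apply/orP; right; rewrite -map_comp.
    by apply/mapP; exists i => //; rewrite memI ij inx; lia.
  by apply: sqdist_expi; rewrite subrr normr0.
move=> z; rewrite mem_circle_set => /mapP[y]; rewrite inE => /orP[/eqP->|/mapP[i]] zE.
  exists (expi (x j)).
    by rewrite mem_circle_set -map_comp; apply/mapP; exists j => //; rewrite mem_iota; lia.
  have := g0 j jk => gj0; rewrite zE.
  by apply: sqdist_expi; rewrite addrC addKr ger0_norm//; lra.
move: zE; rewrite memI => /and3P[_ _ ik] -> ->.
exists (expi (x i)).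
  by rewrite mem_circle_set -map_comp; apply/mapP; exists i => //; rewrite mem_iota; lia.
by apply: sqdist_expi; rewrite subrr normr0.
Qed.

End CircleSets.

(** * The bound for retractions in the Euclidean plane *)

Section PlanarBound.
Context {R : realType}.
Notation plane := (R * R)%type.
Variables (k : nat) (L : R) (rho : {fset plane} -> {fset plane}).
Hypothesis k_gt0 : (0 < k)%N.
Hypothesis L_ge0 : 0 <= L.
Hypothesis rho_card : forall A : {fset plane},
  A != fset0 -> (#|` A| <= k.+1)%N -> (#|` rho A| <= k)%N.
Hypothesis rho_id : forall A : {fset plane},
  A != fset0 -> (#|` A| <= k)%N -> rho A = A.
Hypothesis rho_lip : forall (A A' : {fset plane}) (d : R), 0 <= d ->
  A != fset0 -> (#|` A| <= k.+1)%N -> A' != fset0 -> (#|` A'| <= k.+1)%N ->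
  within_dist d A A' -> within_dist d A' A -> within_dist (L * d) (rho A) (rho A').

Let D : R := pi / k.+1%:R.
Hypothesis small : (L + 1) * D < 1.

Let D_gt0 : 0 < D. Proof. by rewrite divr_gt0// pi_gt0. Qed.
(** Thus [2 * eps = 1 - L * D], the radius of the disc about 0 that [rho_away] keeps free. *)
Let eps : R := (1 - L * D) / 2.
Let eps01 : 0 < eps <= 1.
Proof.
have LD := mulr_ge0 L_ge0 (ltW D_gt0); have := small; have := D_gt0.
by rewrite /eps => ? ?; apply/andP; split; lra.
Qed.

Let arc_k (x : nat -> R) : {fset plane} := circle_set (map x (iota 0 k.+1)).

Let arc_k_neq0 (x : nat -> R) : arc_k x != fset0. Proof. exact: circle_set_neq0. Qed.
Let arc_k_card (x : nat -> R) : (#|` arc_k x| <= k.+1)%N.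
Proof. by rewrite (leq_trans (card_circle_set _))// !size_map size_iota. Qed.

(** [rho] fixes the merged set [C] of unit vectors, and [rho (arc_k x)] lies within [L * D] of it,
    hence of the unit circle. *)
Lemma rho_away (x : nat -> R) : (forall i, (i < k)%N -> x i <= x i.+1) ->
  x k <= x 0%N + 2 * pi -> away eps (rho (arc_k x)).
Proof.
move=> xmon xk b bB.
have [C [C0 Ck Cunit AC CA]] := merge_adjacent k_gt0 xmon xk.
have Ck' := leqW Ck.
have [c cC] := rho_lip (ltW D_gt0) (arc_k_neq0 x) (arc_k_card x) C0 Ck' AC CA bB.
rewrite rho_id// in cC => bc; have := Cunit c cC; move: bc; rewrite /sqdist.
set q := L * D; have q0 : 0 <= q by rewrite mulr_ge0// ltW.
have q1 : q < 1 by have := small; have := D_gt0; rewrite mulrDl mul1r -/q; lra.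
have -> : 2 * eps = 1 - q by rewrite /eps -/q; lra.
move: b.1 b.2 c.1 c.2 => b1 b2 c1 c2 bc c12.
(* Cauchy-Schwarz for the unit vector [c]; then the scalar product of [c] and [b] is at least
   [1 - q], and so is the length of [b]. *)
have cb : c1 * (c1 - b1) + c2 * (c2 - b2) <= q.
  have h : (c1 * (c1 - b1) + c2 * (c2 - b2)) ^+ 2 <= q ^+ 2.
    have := sqr_ge0 (c1 * (c2 - b2) - c2 * (c1 - b1)).
    have : (c1 ^+ 2 + c2 ^+ 2) * ((b1 - c1) ^+ 2 + (b2 - c2) ^+ 2) <= q ^+ 2.
      by rewrite c12 mul1r.
    by nra.
  rewrite (le_trans (ler_norm _))// -(@ler_pXn2r _ 2) ?nnegrE//.
  by rewrite real_normK ?num_real.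
have h : (1 - q) ^+ 2 <= (c1 * b1 + c2 * b2) ^+ 2.
  by rewrite lerXn2r ?nnegrE//; nra.
apply: (le_trans h).
have := sqr_ge0 (c1 * b2 - c2 * b1).
have : (c1 ^+ 2 + c2 ^+ 2) * (b1 ^+ 2 + b2 ^+ 2) = b1 ^+ 2 + b2 ^+ 2.
  by rewrite c12 mul1r.
by nra.
Qed.

(** The way from [(-1, 0)] to [C] costs at most [D], that from [C = rho C] to [rho (arc_k x)] at
    most [L * D]; together this is less than 1. *)
Lemma rho_left (x : nat -> R) : (forall i, (i < k)%N -> x i <= x i.+1) ->
  x k <= x 0%N + 2 * pi -> (-1, 0) \in arc_k x ->
  exists2 b, b \in rho (arc_k x) & b.1 < 0.
Proof.
move=> xmon xk aA.
have [C [C0 Ck _ AC CA]] := merge_adjacent k_gt0 xmon xk.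
have Ck' := leqW Ck.
have [c cC] := within_dist_near (ltW D_gt0) AC aA.
have LD0 := mulr_ge0 L_ge0 (ltW D_gt0).
have lip := rho_lip (ltW D_gt0) C0 Ck' (arc_k_neq0 x) (arc_k_card x) CA AC.
rewrite rho_id// in lip; move=> [ac _].
have [b bB [cb _]] := within_dist_near LD0 lip cC.
exists b => //; have := small; have := D_gt0; move: ac cb.
by rewrite !ler_norml /= => /andP[? ?] /andP[? ?] ? ?; lra.
Qed.

Lemma rho_near (x y : nat -> R) (d : R) : (forall l, `|x l - y l| <= d) ->
  within_dist (L * d) (rho (arc_k x)) (rho (arc_k y)).
Proof.
move=> xy; have d0 : 0 <= d by exact: le_trans (xy 0%N).
have w (u v : nat -> R) : (forall l, `|u l - v l| <= d) ->
    within_dist d (arc_k u) (arc_k v).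
  move=> uv z; rewrite mem_circle_set -map_comp => /mapP[i ik ->].
  exists (expi (v i)); last exact: sqdist_expi.
  by rewrite mem_circle_set -map_comp; apply/mapP; exists i.
by apply: rho_lip => //; apply: w => // l; rewrite distrC.
Qed.

(* The two cases [o = 1], [k] odd and [o = 0], [k] even; in the second one
   the point [(-1, 0) = expi (x 0)] always belongs to the set. *)
Variable o m : nat.
Hypothesis o1 : (o <= 1)%N.
Hypothesis mk : m.+1 = (o + k)%N.

(** The points used are [x o, ..., x m.+1]; [o = 1] leaves out the fixed coordinate [x 0]. *)
Let shift (x : nat -> R) i := x (o + i)%N.
Let F (x : nat -> R) := rho (arc_k (shift x)).

Lemma shift_circle_set (x : nat -> R) n : map (shift x) (iota 0 n) = map x (iota o n).
Proof. by have := iotaDl o 0 n; rewrite addn0 => ->; rewrite -map_comp. Qed.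

Lemma shift_mono (x : nat -> R) : in_simplex (- pi) pi m.+1 x ->
  (forall i, (i < k)%N -> shift x i <= shift x i.+1) /\
  shift x k <= shift x 0 + 2 * pi.
Proof.
move=> xC; case: (xC) => x0 xm xmon; split.
  by move=> i ik; rewrite /shift addnS; apply: xmon; lia.
have : x 0%N <= shift x 0 by apply: (in_simplex_le xC); lia.
have : shift x k <= x m.+2 by apply: (in_simplex_le xC); lia.
by rewrite x0 xm; lra.
Qed.

Lemma expi_pi : expi (pi : R) = (-1, 0) :> plane /\ expi (- pi) = (-1, 0) :> plane.
Proof. by rewrite /expi cosN sinN cospi sinpi oppr0. Qed.

Lemma count_right (B : {fset plane}) b : b \in B -> b.1 < 0 ->
  (count (fun z => (0 < z.1)%R) (enum_fset B) < #|` B|)%N.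
Proof.
move=> bB b0; rewrite -(count_predC (fun z : plane => 0 < z.1) (enum_fset B)).
rewrite -addn1 leq_add2l -has_count; apply/hasP; exists b => //=.
by rewrite -leNgt ltW.
Qed.

(** For [o = 1] there are at most [k = m] points in all; for [o = 0] there may be [k = m + 1], but
    one of them is on the left. *)
Lemma F_thin_away (x : nat -> R) : in_simplex (- pi) pi m.+1 x ->
  thin m (F x) /\ away eps (F x).
Proof.
move=> xC; have [smon sk] := shift_mono xC; split; last exact: rho_away.
have card : (#|` F x| <= k)%N := rho_card (arc_k_neq0 _) (arc_k_card _).
rewrite /thin; case: (posnP o) => [e0|e0]; last first.
  by rewrite (leq_trans (count_size _ _))// (leq_trans card)//; lia.
have [b bF b0] : exists2 b, b \in F x & b.1 < 0.
  apply: rho_left => //; rewrite mem_circle_set; apply/mapP; exists (x 0%N).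
    by apply/mapP; exists 0%N; rewrite ?mem_iota// /shift e0.
  by case: xC => -> _ _; rewrite expi_pi.2.
by rewrite -ltnS mk e0 (leq_trans (count_right bF b0)).
Qed.

(** On such a face two of the [k + 1] points coincide, so [rho] fixes the set. Both ends of the
    simplex go to [(-1, 0)], so the points on the right come from [y 1, ..., y m]. *)
Lemma face_count i : (i <= m.+1)%N -> (o = 0%N \/ (0 < i <= m)%N) ->
  exists r0, forall r, (r0 <= r)%N ->
  iter r sd (complete m.+1 (label eps m \o (fun y => F (y \o degen i))))
    (simplex (- pi) pi m).
Proof.
move=> im oi; apply: identity_count => // y yC z z0; case: (yC) => y0 ym _.
have rhoE : F (y \o degen i) = arc_k (shift (y \o degen i)).
  apply: rho_id => //.
  rewrite (@leq_trans #|` circle_set (map y (iota o k))|)//; last first.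
    by rewrite (leq_trans (card_circle_set _))// size_map size_iota.
  apply/fsubset_leq_card/fsubsetP => w; rewrite /arc_k shift_circle_set !mem_circle_set -!map_comp.
  move=> /mapP[l]; rewrite mem_iota => ol ->.
  (* Equality occurs only for [o = 0] and [i = m + 1]: the last point is then at [pi] and coincides
     with the first, at [- pi]. *)
  have [dm|dm] := eqVneq (degen i l) m.+1; last first.
    apply/mapP; exists (degen i l) => //; rewrite mem_iota.
    by move: dm oi; rewrite /degen; case: (leqP l i) => il dm [] ?; lia.
  have o0 : o = 0%N by move: dm oi; rewrite /degen; case: (leqP l i) => il dm [] ?; lia.
  apply/mapP; exists 0%N; first by rewrite mem_iota o0.
  by rewrite /= dm ym y0 expi_pi.1 expi_pi.2.
rewrite rhoE /arc_k shift_circle_set mem_circle_set -map_comp; split.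
  move=> /mapP[l]; rewrite mem_iota => ol /= ze; exists (degen i l) => //.
  have ym1 : degen i l != 0%N.
    by apply/eqP => d0; move: z0; rewrite ze d0 y0 expi_pi.2 /=; lra.
  have ym2 : degen i l != m.+1.
    by apply/eqP => d0; move: z0; rewrite ze d0 ym expi_pi.1 /=; lra.
  by move: ym1 ym2; rewrite /degen; case: (leqP l i) => il; lia.
move=> [l lm ->]; apply/mapP; exists (if (l <= i)%N then l else l.+1).
  by rewrite mem_iota; case: (leqP l i) => il; lia.
by rewrite /= /degen; case: (leqP l i) => [->//|il]; rewrite ifF//; lia.
Qed.

(** The set contains [(-1, 0)], so its image has a point on the left and at most [m - 1] on the
    right, too few for [m] boxes. *)
Lemma end_face_count i r : (o = 1)%N -> i = 0%N \/ i = m.+1 ->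
  iter r sd (complete m.+1 (label eps m \o (fun y => F (y \o degen i))))
    (simplex (- pi) pi m) = false.
Proof.
move=> o_1 i0; apply: missing_count => // y yC; case: (yC) => y0 ym _.
have xC : in_simplex (- pi) pi m.+1 (y \o degen i).
  by apply: in_simplex_degen => //; lia.
have [smon sk] := shift_mono xC.
have [b bF b0] : exists2 b, b \in F (y \o degen i) & b.1 < 0.
  apply: rho_left => //; rewrite /arc_k shift_circle_set mem_circle_set -map_comp.
  case: i0 => ->; apply/mapP.
    by exists 1%N; [rewrite mem_iota; lia | rewrite /= y0 expi_pi.2].
  by exists m.+1; [rewrite mem_iota; lia | rewrite /= /degen leqnn ym expi_pi.1].
have card : (#|` F (y \o degen i)| <= k)%N := rho_card (arc_k_neq0 _) (arc_k_card _).
have e0 : 0 < eps by case/andP: eps01.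
apply/negP => /(hits_count e0) hc.
have := leq_trans (count_right bF b0) card; rewrite ltnNge (leq_trans _ hc)//; lia.
Qed.

(** The faces that count are the [m = k] inner ones for [o = 1] and all [m + 2 = k + 1] for [o = 0]:
    an odd number, against [faces_count]. *)
Lemma face_parity : (if o == 1 then odd k else ~~ odd k)%N -> False.
Proof.
move=> par.
have [r1 r1P] := faces_count eps01 L_ge0 F_thin_away
  (fun x y d _ _ xy => within_dist_near (mulr_ge0 L_ge0 (le_trans (normr_ge0 _) (xy 0%N)))
     (rho_near (fun l => xy (o + l)%N))).
have [r2 r2P] : exists r0, forall r, (r0 <= r)%N -> forall i, (i < m.+2)%N ->
    iter r sd (complete m.+1 (label eps m \o (fun y => F (y \o degen i))))
      (simplex (- pi) pi m) = (o == 0)%N || (0 < i <= m)%N.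
  apply: eventually_all => i im.
  have [io|] := boolP ((o == 0)%N || (0 < i <= m)%N).
    have [||r0 r0P] := @face_count i; [lia|by case/orP: io => [/eqP|]; [left|right]|].
    by exists r0 => r /r0P ->.
  rewrite negb_or => /andP[ne0 i0]; exists 0%N => r _.
  by apply: end_face_count; lia.
have := r1P (maxn r1 r2) (leq_maxl _ _).
rewrite (eq_big_seq (fun i => (o == 0)%N || (0 < i <= m)%N)); last first.
  by move=> i; rewrite mem_iota add0n => im; apply: r2P => //; exact: leq_maxr.
rewrite big_addb => /negbT/negP; apply.
have -> : iota 0 m.+2 = 0%N :: iota 1 m ++ [:: m.+1].
  by rewrite -addn1 -add1n iotaD iotaD.
rewrite /= count_cat /= ltnn !orbF addn0.
have -> : count (fun i => (o == 0)%N || (0 < i <= m)%N) (iota 1 m) = m.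
  rewrite -[RHS](size_iota 1); apply/eqP; rewrite -all_count.
  by apply/allP => i; rewrite mem_iota => im; apply/orP; right; lia.
move: par mk; case: (o) o1 => [|[|//]] _ /= par mk'.
  by rewrite add0n addn1 mk'.
by move: mk'; rewrite add1n => -[->]; rewrite addn0.
Qed.

End PlanarBound.

Theorem planar_lower_bound (R : realType) (k : nat) (L : R)
    (rho : {fset R * R} -> {fset R * R}) : (0 < k)%N -> 0 <= L ->
  (forall A : {fset R * R},
    A != fset0 -> (#|` A| <= k.+1)%N -> (#|` rho A| <= k)%N) ->
  (forall A : {fset R * R}, A != fset0 -> (#|` A| <= k)%N -> rho A = A) ->
  (forall (A A' : {fset R * R}) (d : R), 0 <= d ->
    A != fset0 -> (#|` A| <= k.+1)%N -> A' != fset0 -> (#|` A'| <= k.+1)%N ->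
    within_dist d A A' -> within_dist d A' A ->
    within_dist (L * d) (rho A) (rho A')) ->
  k.+1%:R <= pi * (L + 1).
Proof.
move=> k0 L0 rcard rid rlip; rewrite leNgt; apply/negP => lt.
have small : (L + 1) * (pi / k.+1%:R) < 1.
  by rewrite mulrA [_ * pi]mulrC ltr_pdivrMr// mul1r.
have [ok|ek] := boolP (odd k).
  exact: (@face_parity _ k L rho k0 L0 rcard rid rlip small 1 k).
apply: (@face_parity _ k L rho k0 L0 rcard rid rlip small 0 k.-1) => //.
by rewrite prednK.
Qed.

(** * Transfer along a Lipschitz projection onto a plane *)

Section PlaneInNormedSpace.
Context {R : realType} (X : normedModType R).
Notation plane := (R * R)%type.
Notation Y := (normed_metric X).
Variables (n k : nat) (r : finite_subset Y n -> finite_subset Y k).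
Hypothesis k_gt0 : (0 < k)%N.
Hypothesis kn : (k < n)%N.
Hypothesis r_retr : lipschitz_retraction r.
Variables (inc : plane -> Y) (P : Y -> plane) (c1 c2 : R).
Hypothesis incK : cancel inc P.
Hypothesis c1_ge0 : 0 <= c1.
Hypothesis c2_ge0 : 0 <= c2.
Hypothesis inc_lip : forall z w,
  mdist (inc z) (inc w) ^+ 2 <= c1 ^+ 2 * sqdist z w.
Hypothesis P_lip : forall x y, sqdist (P x) (P y) <= c2 ^+ 2 * mdist x y ^+ 2.

Fact origin_subproof :
  ([fset 0%R : Y]%fset != fset0) && (#|` [fset 0%R : Y]%fset| <= n)%N.
Proof.
by rewrite -cardfs_gt0 cardfs1 /=; exact: leq_ltn_trans kn.
Qed.

Let origin : finite_subset Y n := FiniteSubset origin_subproof.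

(** The default [origin] only serves sets whose image is empty or has more than [n] points. *)
Let embed (A : {fset plane}) : finite_subset Y n :=
  insubd origin [fset inc z | z in A]%fset.

Let rho (A : {fset plane}) : {fset plane} := [fset P x | x in fset_of (r (embed A))]%fset.

Let embedE (A : {fset plane}) : A != fset0 -> (#|` A| <= k.+1)%N ->
  fset_of (embed A) = [fset inc z | z in A]%fset.
Proof.
move=> A0 Ak; rewrite -[LHS]/(val (embed A)) /embed val_insubd.
rewrite (leq_trans (leq_imfset_card _ _ _)) ?(leq_trans Ak)// andbT.
rewrite ifT//; move/fset0Pn: A0 => [z zA]; apply/fset0Pn; exists (inc z).
by apply/imfsetP; exists z.
Qed.

(** Conjugating [r] by [inc] and [P] keeps small sets fixed, as [P] is a left inverse of [inc], and
    the Lipschitz constants multiply. *)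
Lemma retraction_bound : k.+1%:R <= pi * (c1 * c2 * Lip r + 1).
Proof.
have [rlip rid] := r_retr.
have [[Lr0 Lr] _] := Lip_least rlip.
apply: (@planar_lower_bound R k (c1 * c2 * Lip r) rho k_gt0).
- exact: mulr_ge0 (mulr_ge0 _ _) _.
- move=> A A0 Ak; rewrite (leq_trans (leq_imfset_card _ _ _))//.
  by case: (r (embed A)) => B /= /andP[].
- move=> A A0 Ak; have eA := embedE A0 (leqW Ak).
  have rA : fset_of (r (embed A)) = [fset inc z | z in A]%fset.
    by rewrite rid eA// (leq_trans (leq_imfset_card _ _ _)).
  apply/fsetP => z; rewrite /rho rA; apply/imfsetP/idP => [[_ /imfsetP[w wA ->] ->]|zA].
    by rewrite incK.
  by exists (inc z); rewrite ?incK//; apply/imfsetP; exists z.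
move=> A A' d d0 A0 Ak A'0 A'k AA' A'A.
have exc (B B' : {fset plane}) : B != fset0 -> within_dist d B B' ->
    excess [fset inc z | z in B]%fset [fset inc z | z in B']%fset <= c1 * d.
  move=> /fset0Pn[b bB] BB'.
  have B0 : [fset inc z | z in B]%fset != fset0.
    by apply/fset0Pn; exists (inc b); apply/imfsetP; exists b.
  have [_ /imfsetP[z zB ->] ->] := excess_max [fset inc z | z in B']%fset B0.
  have [w wB' zw] := BB' z zB.
  apply: (@le_trans _ _ (mdist (inc z) (inc w))).
    by apply: dist_to_le; apply/imfsetP; exists w.
  rewrite -(@ler_pXn2r _ 2) ?nnegrE ?mdist_ge0 ?mulr_ge0//.
  by rewrite (le_trans (inc_lip z w))// exprMn ler_wpM2l// exprn_ge0.
have dist_le : mdist (embed A) (embed A') <= c1 * d.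
  rewrite -[mdist _ _]/(hausdorff_dist (embed A) (embed A')) /hausdorff_dist.
  by rewrite !embedE// ge_max !exc.
move=> _ /imfsetP[x xA ->].
have rA'0 : fset_of (r (embed A')) != fset0 by case: (r (embed A')) => B /= /andP[].
have [y yA' xy] := dist_to_min x rA'0.
exists (P y); first by apply/imfsetP; exists y.
have xyd : mdist x y <= Lip r * (c1 * d).
  rewrite -xy (le_trans (excess_ge _ xA))//.
  apply: (@le_trans _ _ (mdist (r (embed A)) (r (embed A')))).
    rewrite -[leRHS]/(hausdorff_dist (r (embed A)) (r (embed A'))).
    by rewrite /hausdorff_dist le_max lexx.
  by rewrite (le_trans (Lr _ _))// ler_wpM2l.
apply: (le_trans (P_lip x y)).
have -> : c1 * c2 * Lip r * d = c2 * (Lip r * (c1 * d)) by lra.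
rewrite [leRHS]exprMn ler_wpM2l ?exprn_ge0// lerXn2r ?nnegrE ?mdist_ge0//.
by rewrite !mulr_ge0.
Qed.

End PlaneInNormedSpace.

(** * Lipschitz coordinates on a plane in a normed space *)

Lemma mcshane_extension (R : realType) (X : normedModType R) (T : Type) (t0 : T)
    (g : T -> R) (v : T -> X) (K : R) : 0 <= K ->
  (forall s t, g s - g t <= K * `|v s - v t|) ->
  exists F : X -> R, (forall t, F (v t) = g t) /\
    forall x y, `|F x - F y| <= K * `|x - y|.
Proof.
(* The extension is the infimum of these cones; [t0] makes the family nonempty and bounded below. *)
move=> K0 gv; pose E x := [set g t + K * `|x - v t| | t in [set: T]].
have lbE x : has_lbound (E x).
  exists (g t0 - K * `|x - v t0|) => _ [t _ <-].
  have := gv t0 t; have : K * `|v t0 - v t| <= K * `|v t0 - x| + K * `|x - v t|.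
    by rewrite -mulrDr ler_wpM2l// ler_distD.
  rewrite (distrC (v t0) x); lra.
have E0 x : E x !=set0 by exists (g t0 + K * `|x - v t0|); exists t0.
have lip x y : inf (E x) <= inf (E y) + K * `|x - y|.
  rewrite -lerBlDr; apply: lb_le_inf => // _ [t _ <-].
  have : inf (E x) <= g t + K * `|x - v t| by apply: ge_inf => //; exists t.
  have : K * `|x - v t| <= K * `|x - y| + K * `|y - v t|.
    by rewrite -mulrDr ler_wpM2l// ler_distD.
  lra.
exists (fun x => inf (E x)); split=> [t|x y].
  apply/eqP; rewrite eq_le; apply/andP; split.
    by apply: ge_inf => //; exists t => //; rewrite subrr normr0 mulr0 addr0.
  by apply: lb_le_inf => // _ [s _ <-]; have := gv t s; lra.
rewrite ler_norml; have := lip x y; have := lip y x; rewrite (distrC y x) => ? ?.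
by apply/andP; split; lra.
Qed.

(** For large [b] the norm is at least that of [u], and on the remaining compact interval its
    minimum is attained. *)
Lemma dist_line_gt0 (R : realType) (X : normedModType R) (u v : X) : v != 0 ->
  (forall b, u + b *: v != 0) -> exists2 d, 0 < d & forall b, d <= `|u + b *: v|.
Proof.
move=> v0 uv; have nv : 0 < `|v| by rewrite normr_gt0.
have nu : 0 < `|u| by rewrite normr_gt0; have := uv 0; rewrite scale0r addr0.
pose M := 2 * `|u| / `|v|; have M0 : 0 < M by rewrite divr_gt0 ?mulr_gt0.
pose f b := `|u + b *: v|.
have cf : continuous f.
  move=> b; apply: cvg_norm; apply: cvgD; first exact: cvg_cst.
  exact: scalel_continuous.
have [|c _ fc] := @EVT_min R f (- M) M _ (continuous_subspaceT cf); first lra.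
have f0 : 0 < f c by rewrite normr_gt0.
exists (Num.min (f c) `|u|); first by rewrite lt_min f0 nu.
move=> b; rewrite ge_min; have [bM|bM] := leP `|b| M.
  by rewrite fc// in_itv/= -ler_norml.
apply/orP; right.
have : `|b *: v| <= `|u + b *: v| + `|u|.
  by rewrite -{1}[b *: v](addKr u) addrC (le_trans (ler_normB _ _)).
suff : 2 * `|u| <= `|b *: v| by lra.
by rewrite normrZ -ler_pdivrMr// ltW.
Qed.

Lemma dim2_pair (R : realType) (X : lmodType R) : dim_ge X 2 ->
  exists e1 e2 : X, forall a b, a *: e1 + b *: e2 = 0 -> a = 0 /\ b = 0.
Proof.
move=> [e eP]; exists (e ord0), (e (lift ord0 ord0)) => a b ab.
have := eP (fun i => if i == ord0 then a else b).
rewrite !big_ord_recl big_ord0 /= addr0 => /(_ ab) c0.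
by split; [exact: (c0 ord0) | exact: (c0 (lift ord0 ord0))].
Qed.

Lemma coordinate_bound (R : realType) (X : normedModType R) (e1 e2 : X) :
  (forall a b : R, a *: e1 + b *: e2 = 0 -> a = 0 /\ b = 0) ->
  exists2 d, 0 < d & forall a b, d * `|a| <= `|a *: e1 + b *: e2|.
Proof.
move=> ind; have e20 : e2 != 0.
  apply/eqP => e0; have [] := ind 0 1; first by rewrite scale0r e0 scaler0 addr0.
  by move=> _ /eqP; rewrite oner_eq0.
have [b|d d0 dP] := @dist_line_gt0 R X e1 e2 e20.
  apply/eqP => e0; have [] := ind 1 b; first by rewrite scale1r.
  by move/eqP; rewrite oner_eq0.
exists d => // a b; have [->|a0] := eqVneq a 0; first by rewrite normr0 mulr0.
have -> : a *: e1 + b *: e2 = a *: (e1 + (b / a) *: e2).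
  by rewrite scalerDr scalerA mulrCA divff// mulr1.
by rewrite normrZ mulrC ler_wpM2l.
Qed.

(* Up to the factor [1 + d], an Auerbach basis of a plane in [X], obtained by
   almost maximizing a determinant over pairs of vectors of the unit ball. *)
Lemma almost_auerbach (R : realType) (X : normedModType R) (d : R) :
  dim_ge X 2 -> 0 < d ->
  exists u w : X, [/\ `|u| <= 1, `|w| <= 1 & forall a b : R,
    `|a| <= (1 + d) * `|a *: u + b *: w| /\
    `|b| <= (1 + d) * `|a *: u + b *: w|].
Proof.
move=> /dim2_pair[e1 [e2 ind]] d0.
have ind' (a b : R) : a *: e2 + b *: e1 = 0 -> a = 0 /\ b = 0.
  by rewrite addrC => /ind[].
have [c1 c10 c1P] := coordinate_bound ind.
have [c2 c20 c2P] := coordinate_bound ind'.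
pose vec (p : R * R) := p.1 *: e1 + p.2 *: e2.
pose det (p q : R * R) := p.1 * q.2 - p.2 * q.1.
have vecZ a p : vec (a * p.1, a * p.2) = a *: vec p.
  by rewrite /vec /= scalerDr !scalerA.
pose E := [set det pq.1 pq.2 | pq in
  [set pq : (R * R) * (R * R) | `|vec pq.1| <= 1 /\ `|vec pq.2| <= 1]].
have coord p : `|vec p| <= 1 -> `|p.1| <= c1^-1 /\ `|p.2| <= c2^-1.
  move=> p1; split; rewrite -[leRHS]mul1r ler_pdivlMr// mulrC.
    exact: le_trans (c1P _ _) p1.
  by rewrite (le_trans (c2P p.2 p.1))// addrC.
have hE : has_ubound E.
  exists (c1^-1 * c2^-1 + c2^-1 * c1^-1) => _ [[p q] [/= /coord[p1 p2] /coord[q1 q2]] <-].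
  rewrite (le_trans (ler_norm _))// (le_trans (ler_normB _ _))// !normrM.
  by rewrite lerD// ler_pM.
have e10 : 0 < `|e1|.
  rewrite normr_gt0; apply/eqP => e0; have [] := ind 1 0.
    by rewrite e0 scaler0 scale0r addr0.
  by move/eqP; rewrite oner_eq0.
have e20 : 0 < `|e2|.
  rewrite normr_gt0; apply/eqP => e0; have [] := ind 0 1.
    by rewrite e0 scaler0 scale0r addr0.
  by move=> _ /eqP; rewrite oner_eq0.
have Ee : E (`|e1|^-1 * `|e2|^-1).
  exists ((`|e1|^-1, 0), (0, `|e2|^-1)); last by rewrite /det /= mul0r subr0.
  rewrite /vec /= !scale0r addr0 add0r !normrZ !gtr0_norm ?invr_gt0//.
  by rewrite !mulVf ?gt_eqF.
have S0 : 0 < sup E.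
  by rewrite (lt_le_trans _ (ub_le_sup hE Ee))// mulr_gt0 ?invr_gt0.
(* Instead of a maximizing pair, one within the factor [1 + d] of the supremum is taken. *)
have lt_sup : sup E / (1 + d) < sup E by rewrite ltr_pdivrMr ?ltr_pMr; lra.
have [_ [[p q] [/= p1 q1] <-] detpq] := sup_gt (ex_intro _ _ Ee) lt_sup.
have detpq0 : 0 < det p q by rewrite (le_lt_trans _ detpq)// divr_ge0; lra.
have supE : sup E <= (1 + d) * det p q.
  by rewrite mulrC -ler_pdivrMr ?ltW//; lra.
have det_le x y : `|vec y| <= 1 -> det x y <= sup E * `|vec x|.
  move=> y1; have [x0|x0] := eqVneq (vec x) 0.
    have [x1 x2] := ind _ _ x0.
    by rewrite x0 normr0 mulr0 /det x1 x2 !mul0r subrr.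
  have nx : 0 < `|vec x| by rewrite normr_gt0.
  rewrite -ler_pdivrMr//; apply: ub_le_sup => //.
  exists ((`|vec x|^-1 * x.1, `|vec x|^-1 * x.2), y); last by rewrite /det /=; lra.
  by rewrite /= vecZ normrZ gtr0_norm ?invr_gt0// mulVf ?gt_eqF.
have det_abs x y : `|vec y| <= 1 -> `|det x y| <= sup E * `|vec x|.
  move=> y1; rewrite ler_norml det_le// andbT lerNl.
  have := det_le (-1 * x.1, -1 * x.2) y y1; rewrite vecZ normrZ normrN1 mul1r.
  by rewrite /det /=; lra.
exists (vec p), (vec q); split=> // a b.
pose z := (a * p.1 + b * q.1, a * p.2 + b * q.2).
have <- : vec z = a *: vec p + b *: vec q.
  by rewrite /vec /z /= !scalerDr !scalerA !scalerDl addrACA.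
have key c : `|c * det p q| <= sup E * `|vec z| -> `|c| <= (1 + d) * `|vec z|.
  rewrite normrM (gtr0_norm detpq0) => h; rewrite -(ler_pM2r detpq0).
  by rewrite (le_trans h)// mulrAC ler_wpM2r.
(* Cramer's rule: [a * det p q = det z q] and [b * det p q = - det z p]. *)
split; apply: key.
  by rewrite (_ : _ * _ = det z q) ?det_abs// /det /z /=; ring.
rewrite (_ : _ * _ = - det z p); last by rewrite /det /z /=; ring.
by rewrite normrN det_abs.
Qed.

(** * Normed spaces and Hilbert spaces *)

Section MainBound.
Context {R : realType} (X : normedModType R).
Notation Y := (normed_metric X).
Variables (n k : nat) (r : finite_subset Y n -> finite_subset Y k).
Hypothesis k_gt0 : (0 < k)%N.
Hypothesis kn : (k < n)%N.
Hypothesis r_retr : lipschitz_retraction r.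

Lemma mdist_normE (x y : Y) : mdist x y = `|(x : X) - y|.
Proof. by []. Qed.

(** In an almost Auerbach basis the inclusion has constant [sqrt 2], by comparing the sum norm with
    the Euclidean one, and the pair of extended coordinates has [sqrt 2 * (1 + d)]. Then [d] tends
    to 0. *)
Lemma normed_bound : dim_ge X 2 -> k.+1%:R <= pi * (2 * Lip r + 1).
Proof.
move=> hX; have [[L0 _] _] := Lip_least r_retr.1.
have H d : 0 < d -> k.+1%:R <= pi * (2 * (1 + d) * Lip r + 1).
  move=> d0; have [u [w [u1 w1 uw]]] := almost_auerbach hX d0.
  have K0 : 0 <= 1 + d by lra.
  pose v (z : R * R) : X := z.1 *: u + z.2 *: w.
  have vB z z' : v z - v z' = (z.1 - z'.1) *: u + (z.2 - z'.2) *: w.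
    by rewrite /v !scalerBl opprD addrACA.
  have [F1 [F1v F1l]] := @mcshane_extension R X _ (0, 0) fst v (1 + d) K0
    (fun s t => le_trans (ler_norm _) (eq_ind_r (fun x => _ <= _ * `|x|)
      (uw _ _).1 (vB s t))).
  have [F2 [F2v F2l]] := @mcshane_extension R X _ (0, 0) snd v (1 + d) K0
    (fun s t => le_trans (ler_norm _) (eq_ind_r (fun x => _ <= _ * `|x|)
      (uw _ _).2 (vB s t))).
  have s2 : Num.sqrt 2 ^+ 2 = 2 :> R by rewrite sqr_sqrtr.
  have -> : 2 * (1 + d) * Lip r = Num.sqrt 2 * (Num.sqrt 2 * (1 + d)) * Lip r.
    by rewrite mulrA -expr2 s2.
  apply: (@retraction_bound R X n k r k_gt0 kn r_retr v (fun x => (F1 x, F2 x))).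
  - by move=> z; rewrite F1v F2v; case: z.
  - exact: sqrtr_ge0.
  - by rewrite mulr_ge0// sqrtr_ge0.
  - move=> z z'; rewrite mdist_normE vB s2 /sqdist.
    move: (z.1 - z'.1) (z.2 - z'.2) => a b.
    have : `|a *: u + b *: w| <= `|a| + `|b|.
      by rewrite (le_trans (ler_normD _ _))// !normrZ lerD// ler_piMr.
    rewrite -(@ler_pXn2r _ 2 _ `|_|) ?nnegrE ?addr_ge0// => h.
    apply: (le_trans h); have := sqr_ge0 (`|a| - `|b|).
    by have := real_normK (num_real a); have := real_normK (num_real b); nra.
  move=> x y; rewrite mdist_normE exprMn s2 /sqdist /=.
  have sq (F : X -> R) : `|F x - F y| <= (1 + d) * `|(x : X) - y| ->
      (F x - F y) ^+ 2 <= (1 + d) ^+ 2 * `|(x : X) - y| ^+ 2.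
    by move=> h; rewrite -(real_normK (num_real (F x - F y))) -exprMn
      lerXn2r ?nnegrE ?mulr_ge0.
  by have := sq _ (F1l x y); have := sq _ (F2l x y); lra.
rewrite leNgt; apply/negP => lt.
have p0 := pi_gt0 R.
pose K := 2 * pi * Lip r + 1; have K0 : 0 < K by rewrite ltr_wpDl// !mulr_ge0// ltW.
(* So small that the extra term [2 * pi * d * Lip r] stays below the assumed excess. *)
pose d := (k.+1%:R - pi * (2 * Lip r + 1)) / K.
have d0 : 0 < d by rewrite divr_gt0// subr_gt0.
have dK : d * (2 * pi * Lip r) + d = k.+1%:R - pi * (2 * Lip r + 1).
  by rewrite -[X in _ + X]mulr1 -mulrDr divfK ?gt_eqF.
by have := H d d0; nra.
Qed.

(** Gram-Schmidt gives an orthonormal pair, whose inclusion is an isometry; by Bessel's inequality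
    the orthogonal projection is 1-Lipschitz. *)
Lemma hilbert_bound : dim_ge X 2 -> is_hilbert X -> k.+1%:R <= pi * (Lip r + 1).
Proof.
move=> /dim2_pair[e1 [e2 ind]] [[ip ipE] _].
have ipC x y : ip x y = ip y x by rewrite hermC expr0 mul1r.
have ipD x y z : ip (x + y) z = ip x z + ip y z by rewrite linearDl.
have ipZ a x z : ip (a *: x) z = a * ip x z by rewrite linearZl_LR.
have ipB x y z : ip (x - y) z = ip x z - ip y z by rewrite linearBl.
have unit (x : X) : x != 0 -> exists c, ip (c *: x) (c *: x) = 1.
  move=> x0; have nx : `|x| != 0 by rewrite normr_eq0.
  exists `|x|^-1.
  by rewrite ipE normrZ gtr0_norm ?invr_gt0 ?normr_gt0// mulVf// expr1n.
have e10 : e1 != 0.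
  apply/eqP => e0; have [] := ind 1 0; first by rewrite e0 scaler0 scale0r addr0.
  by move/eqP; rewrite oner_eq0.
have [c [u [uE u1]]] : exists c u, u = c *: e1 /\ ip u u = 1.
  by have [c u1] := unit e1 e10; exists c, (c *: e1).
have e2u : e2 - ip e2 u *: u != 0.
  apply/eqP => e0; have [] := ind (- (ip e2 u * c)) 1.
    by rewrite scale1r scaleNr addrC -scalerA -uE.
  by move=> _ /eqP; rewrite oner_eq0.
have [c' [w [wE w1]]] : exists c' w, w = c' *: (e2 - ip e2 u *: u) /\ ip w w = 1.
  by have [c' w1] := unit _ e2u; exists c', (c' *: (e2 - ip e2 u *: u)).
have wu : ip w u = 0 by rewrite wE ipZ ipB ipZ u1 mulr1 subrr mulr0.
have norm2 a b : `|a *: u + b *: w| ^+ 2 = a ^+ 2 + b ^+ 2.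
  rewrite -ipE ipD !ipZ (ipC u) (ipC w) !ipD !ipZ u1 w1 (ipC u w) wu; ring.
have bessel x : ip x u ^+ 2 + ip x w ^+ 2 <= `|x| ^+ 2.
  have [y yE] : exists y, y = ip x u *: u + ip x w *: w by exists (ip x u *: u + ip x w *: w).
  have yy : ip y y = ip x u ^+ 2 + ip x w ^+ 2 by rewrite ipE yE norm2.
  have yx : ip y x = ip x u ^+ 2 + ip x w ^+ 2.
    by rewrite yE ipD !ipZ (ipC u) (ipC w) -!expr2.
  have := sqr_ge0 `|x - y|.
  by rewrite -!ipE ipB (ipC x (x - y)) (ipC y (x - y)) !ipB (ipC x y) yy yx; lra.
pose v (z : R * R) : X := z.1 *: u + z.2 *: w.
have -> : Lip r = 1 * 1 * Lip r by rewrite !mul1r.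
apply: (@retraction_bound R X n k r k_gt0 kn r_retr v (fun x => (ip x u, ip x w))).
- by move=> [a b]; rewrite /v /= !ipD !ipZ u1 w1 wu (ipC u w) wu; congr pair; ring.
- exact: ler01.
- exact: ler01.
- move=> z z'; rewrite mdist_normE expr1n mul1r /sqdist.
  have -> : v z - v z' = (z.1 - z'.1) *: u + (z.2 - z'.2) *: w.
    by rewrite /v !scalerBl opprD addrACA.
  by rewrite norm2.
by move=> x y; rewrite mdist_normE expr1n mul1r /sqdist /= -!ipB.
Qed.

End MainBound.

Theorem theorem1p1 (R : realType) (X : normedModType R) (hX : dim_ge X 2)
    (n k : nat) (hk : (1 <= k <= n - 1)%N)
    (r : finite_subset (normed_metric X) n -> finite_subset (normed_metric X) k)
    (hr : lipschitz_retraction r) :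
  Lip r >= k%:R * n%:R / (2 * pi * (n%:R - 1)) - 1 / 2 /\
  (is_hilbert X -> Lip r >= k%:R * n%:R / (pi * (n%:R - 1)) - 1).
Proof.
have k0 : (0 < k)%N by lia.
have kn : (k < n)%N by lia.
have p0 := pi_gt0 R.
have n1 : 0 < n%:R - 1 :> R by rewrite subr_gt0 ltr1n; lia.
(* Since [k + 1 <= n], the quotient [k * n / (n - 1)] is at most [k + 1], for which the bounds are
   already proved. *)
have knR : k%:R * n%:R <= k.+1%:R * (n%:R - 1) :> R.
  have : k.+1%:R <= n%:R :> R by rewrite ler_nat.
  by rewrite -natr1; nra.
split=> [|hH].
  have b := normed_bound k0 kn hr hX.
  rewrite lerBlDr ler_pdivrMr ?mulr_gt0// (le_trans knR)//.
  rewrite mulrA; apply: ler_wpM2r; [exact: ltW | lra].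
have b := hilbert_bound k0 kn hr hX hH.
rewrite lerBlDr ler_pdivrMr ?mulr_gt0// (le_trans knR)//.
rewrite mulrA; apply: ler_wpM2r; [exact: ltW | lra].
Qed.
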